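(* Let $n\ge 1$ and let $\alpha\in W^{1,\infty}(\partial\Omega;\mathbb{R})$ be such that $\alpha\ge 0$ and $x\cdot\nabla\alpha\le 0$ on $\partial\Omega$ (almost everywhere). Then the Robin Laplacian $-\Delta_\alpha^\Omega$ on the half-space $\Omega$ has no eigenvalues, i.e. $\sigma_{\mathrm p}(-\Delta_\alpha^\Omega)=\varnothing$.
   Context: $\Omega:=\mathbb{R}^{n-1}\times(0,\infty)$ is the upper half-space, and its boundary $\partial\Omega$ is identified with $\mathbb{R}^{n-1}$; points are written $x=(x',x_n)\in\mathbb{R}^{n-1}\times\mathbb{R}$, so that on $\partial\Omega$ the expression $x\cdot\nabla\alpha$ means $x'\cdot\nabla_{x'}\alpha(x')$ (for $n=1$ the boundary is a point, $\alpha$ is a number and this condition is void). For $\alpha\in L^\infty(\partial\Omega;\mathbb{C})$, the Robin Laplacian $-\Delta_\alpha^\Omega$ is the m-sectorial operator in $L^2(\Omega)$ associated, via the first representation theorem, with the closed quadratic form $h_\alpha[u]:=\int_\Omega|\nabla u|^2\,dx+\int_{\partial\Omega}\alpha|u|^2\,d\sigma$, $\mathcal{D}(h_\alpha):=H^1(\Omega)$, where boundary values are traces and $d\sigma$ is the surface measure. That is, $u\in\mathcal{D}(-\Delta_\alpha^\Omega)$ iff $u\in H^1(\Omega)$ and there is $w_u\in L^2(\Omega)$ such that $\int_\Omega\nabla u\cdot\overline{\nabla v}\,dx+\int_{\partial\Omega}\alpha u\bar v\,d\sigma=\int_\Omega w_u\bar v\,dx$ for all $v\in H^1(\Omega)$,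 and then $-\Delta_\alpha^\Omega u:=w_u$. $\sigma_{\mathrm p}(H)$ denotes the set of eigenvalues of a closed operator $H$. *)

(* Defs.v *)
From HB Require Import structures.
From mathcomp Require Import all_boot all_order all_algebra.
From mathcomp Require Import complex.
From mathcomp Require Import all_classical all_reals all_analysis.

Set Implicit Arguments.
Unset Strict Implicit.
Unset Printing Implicit Defensive.

Import Order.TTheory GRing.Theory Num.Theory.
Import numFieldNormedType.Exports.

Local Open Scope classical_set_scope.
Local Open Scope ring_scope.
Local Open Scope complex_scope.

(* As for n.-tuple T in the library, 'rV[R]_n carries the product of the Borel
   sigma-algebras, i.e. the smallest one making all coordinates measurable. *)
Definition measure_rV_display : measure_display.
Proof. exact: default_measure_display. Qed.

Section measurable_rV.
Context (R : realType) (n : nat).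

Let coord : 'I_n -> 'rV[R]_n -> R := fun i x => x ord0 i.

Let rV_set0 : g_sigma_preimage coord set0.
Proof. exact: sigma_algebra0. Qed.

Let rV_setC A : g_sigma_preimage coord A -> g_sigma_preimage coord (~` A).
Proof. exact: sigma_algebraC. Qed.

Let rV_bigcup (F : _^nat) : (forall i, g_sigma_preimage coord (F i)) ->
  g_sigma_preimage coord (\bigcup_i (F i)).
Proof. exact: sigma_algebra_bigcup. Qed.

HB.instance Definition _ := @isMeasurable.Build measure_rV_display
  'rV[R]_n (g_sigma_preimage coord) rV_set0 rV_setC rV_bigcup.

Lemma measurable_rV_coord (i : 'I_n) :
  measurable_fun [set: 'rV[R]_n] (fun x : 'rV[R]_n => x ord0 i).
Proof.
move=> _ Y mY; rewrite setTI; apply: sub_sigma_algebra => /=.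
rewrite -bigcup_seq/=; exists i => /=; first by rewrite mem_index_enum.
by exists Y => //; rewrite setTI.
Qed.

Lemma measurable_fun_rVP d (T : measurableType d) (f : T -> 'rV[R]_n) :
  (forall i, measurable_fun [set: T] (fun t => f t ord0 i)) ->
  measurable_fun [set: T] f.
Proof.
move=> mf _ A mA; rewrite setTI.
suff : g_sigma_preimage coord `<=` [set B | measurable (f @^-1` B)].
  exact.
apply: smallest_sub.
  split=> [|B mB|F mF] /=.
  - by rewrite preimage_set0.
  - by rewrite setTD preimage_setC; apply: measurableC; exact: mB.
  - by rewrite preimage_bigcup; apply: bigcup_measurable => k _; exact: mF.
rewrite -bigcup_seq => B [i _] [C mC <-] /=.
by rewrite setTI -[X in measurable X]setTI; exact: mf.
Qed.

End measurable_rV.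

Section lebesgue_rV.
Context {R : realType}.

(* the point (x', t) of R^n x R = R^(n+1) *)
Definition rV_snoc n (x : 'rV[R]_n) (t : R) : 'rV[R]_n.+1 :=
  \row_i oapp (x ord0) t (unlift ord_max i).

Lemma measurable_rV_snoc n :
  measurable_fun [set: 'rV[R]_n * measurableTypeR R] (fun p => rV_snoc p.1 p.2).
Proof.
apply: measurable_fun_rVP => i; rewrite /rV_snoc.
under eq_fun do rewrite mxE.
case: (unlift _ _) => [j|] /=; last exact: measurable_snd.
exact: (measurableT_comp (measurable_rV_coord j) measurable_fst).
Qed.

(* image of mu \x lebesgue_measure under (x', t) |-> rV_snoc x' t *)
Definition rV_snoc_measure n (mu : {measure set 'rV[R]_n -> \bar R}) :
    {measure set 'rV[R]_n.+1 -> \bar R} :=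
  measure_function_pushforward__canonical__measure_function_Measure
    (mu \x lebesgue_measure)%E (measurable_rV_snoc (n := n)).

(* n-dimensional Lebesgue measure on Borel sets; on the point R^0 it is the
   unit mass *)
Fixpoint lebesgue_rV n : {measure set 'rV[R]_n -> \bar R} :=
  match n with
  | 0 => \d_(0 : 'rV[R]_0)
  | m.+1 => rV_snoc_measure (lebesgue_rV m)
  end.
End lebesgue_rV.

Section sobolev.
Context {R : realType}.
Implicit Type n : nat.

Definition partial n (i : 'I_n) (f : 'rV[R]_n -> R) : 'rV[R]_n -> R :=
  fun x => 'D_(delta_mx ord0 i) f x.

Fixpoint Ck n (k : nat) (f : 'rV[R]_n -> R) : Prop :=
  match k with
  | 0 => continuous f
  | l.+1 => continuous f /\
      forall i, (forall x, derivable f x (delta_mx ord0 i)) /\ Ck l (partial i f)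
  end.

Definition fsupport n (f : 'rV[R]_n -> R) : set 'rV[R]_n :=
  closure [set x | f x != 0].

(* C_c^oo(U) *)
Definition test_function n (U : set 'rV[R]_n) (phi : 'rV[R]_n -> R) : Prop :=
  [/\ forall k, Ck k phi, compact (fsupport phi) & fsupport phi `<=` U].

(* L^p(U), for functions whose values outside U are irrelevant *)
Definition Lp n (U : set 'rV[R]_n) (p : \bar R) (f : 'rV[R]_n -> R) : Prop :=
  f \_ U \in Lfun (lebesgue_rV n) p.

Definition weak_partial n (U : set 'rV[R]_n) (i : 'I_n)
    (f g : 'rV[R]_n -> R) : Prop :=
  forall phi, test_function U phi ->
    \int[lebesgue_rV n]_(x in U) (f x * partial i phi x) =
    - \int[lebesgue_rV n]_(x in U) (g x * phi x).

(* f belongs to W^{1,p}(U) and Df is its weak gradient *)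
Definition W1p n (U : set 'rV[R]_n) (p : \bar R) (f : 'rV[R]_n -> R)
    (Df : 'I_n -> 'rV[R]_n -> R) : Prop :=
  Lp U p f /\ forall i, Lp U p (Df i) /\ weak_partial U i f (Df i).

End sobolev.

Section complex_valued.
Context {R : realType}.
Implicit Type n : nat.

Definition ReF T (f : T -> R[i]) : T -> R := fun x => complex.Re (f x).
Definition ImF T (f : T -> R[i]) : T -> R := fun x => complex.Im (f x).

Definition cintegral n (U : set 'rV[R]_n) (f : 'rV[R]_n -> R[i]) : R[i] :=
  (\int[lebesgue_rV n]_(x in U) ReF f x) +i*
  (\int[lebesgue_rV n]_(x in U) ImF f x).

Definition L2 n (U : set 'rV[R]_n) (f : 'rV[R]_n -> R[i]) : Prop :=
  Lp U 2%:E (ReF f) /\ Lp U 2%:E (ImF f).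

(* u belongs to H^1(U; C) and Du is its weak gradient *)
Definition H1 n (U : set 'rV[R]_n) (u : 'rV[R]_n -> R[i])
    (Du : 'I_n -> 'rV[R]_n -> R[i]) : Prop :=
  W1p U 2%:E (ReF u) (fun i => ReF (Du i)) /\
  W1p U 2%:E (ImF u) (fun i => ImF (Du i)).

Definition cvg_L2 n (U : set 'rV[R]_n) (f_ : nat -> 'rV[R]_n -> R[i])
    (f : 'rV[R]_n -> R[i]) : Prop :=
  Lnorm (lebesgue_rV n) 2%:E (EFin \o ((fun x => Normc.normc (f_ k x - f x)) \_ U))
    @[k --> \oo] --> 0%E.

Definition ctest_function n (phi : 'rV[R]_n -> R[i]) : Prop :=
  test_function setT (ReF phi) /\ test_function setT (ImF phi).

Definition cpartial n (i : 'I_n) (f : 'rV[R]_n -> R[i]) : 'rV[R]_n -> R[i] :=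
  fun x => partial i (ReF f) x +i* partial i (ImF f) x.

End complex_valued.

Section robin.
Context {R : realType} {d : nat}.

(* Omega = R^d x (0, +oo) in R^n, n = d + 1; its boundary is identified with R^d *)
Definition half_space : set 'rV[R]_d.+1 := [set x | 0 < x ord0 ord_max].

(* g is the trace on the boundary of u in H^1(Omega), Du being the gradient of
   u. The trace operator H^1(Omega) -> L^2(boundary) is the continuous extension
   of the restriction to the boundary of C_c^oo functions on R^(d+1), which are
   dense in H^1(Omega); this is its graph. *)
Definition is_trace (u : 'rV[R]_d.+1 -> R[i])
    (Du : 'I_d.+1 -> 'rV[R]_d.+1 -> R[i]) (g : 'rV[R]_d -> R[i]) : Prop :=
  L2 setT g /\
  exists phi : nat -> 'rV[R]_d.+1 -> R[i],
    [/\ forall k, ctest_function (phi k),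
        cvg_L2 half_space phi u,
        forall i, cvg_L2 half_space (fun k => cpartial i (phi k)) (Du i) &
        cvg_L2 setT (fun k y => phi k (rV_snoc y 0)) g].

(* sesquilinear form h_alpha(u, v), given the gradients and the traces *)
Definition robin_form (alpha : 'rV[R]_d -> R[i])
    (Du : 'I_d.+1 -> 'rV[R]_d.+1 -> R[i]) (gu : 'rV[R]_d -> R[i])
    (Dv : 'I_d.+1 -> 'rV[R]_d.+1 -> R[i]) (gv : 'rV[R]_d -> R[i]) : R[i] :=
  cintegral half_space (fun x => \sum_i Du i x * (Dv i x)^*) +
  cintegral setT (fun y => alpha y * gu y * (gv y)^*).

(* The Robin Laplacian, as the set of pairs (u, w) such that u is in its domain
   and w is the image of u in L^2(Omega); functions equal almost everywhere on
   Omega are not distinguished. *)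
Definition robin_laplacian (alpha : 'rV[R]_d -> R[i]) :
    set (('rV[R]_d.+1 -> R[i]) * ('rV[R]_d.+1 -> R[i])) :=
  [set uw | L2 half_space uw.2 /\
    exists Du gu, [/\ H1 half_space uw.1 Du, is_trace uw.1 Du gu &
      forall v Dv gv, H1 half_space v Dv -> is_trace v Dv gv ->
        robin_form alpha Du gu Dv gv =
        cintegral half_space (fun x => uw.2 x * (v x)^*)]].

End robin.

(* sigma_p(H) for an operator H in L^2(U) given by its graph *)
Definition point_spectrum (R : realType) n (U : set 'rV[R]_n)
    (H : set (('rV[R]_n -> R[i]) * ('rV[R]_n -> R[i]))) : set R[i] :=
  [set lambda | exists u, H (u, fun x => lambda * u x) /\
    ~ (u = cst 0 %[ae lebesgue_rV n in U])].

(* Main.v *)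
(* Only dilations in the normal variable, D_s(x', t) = (x', s t), are used.
   They fix the boundary, so u o D_s is an admissible test function with the
   same trace as u. An eigenvalue lambda of the eigenfunction u is real (test
   with u). Put f = D_n u, A = int alpha |u|^2 >= 0 on the boundary,
   P(s) = Re (D'u, D'u o D_s) - lambda Re (u, u o D_s). Testing with u o D_s gives
     s Re (f, f o D_s) + P(s) + A = 0.
   A change of variables turns the same identity at 1/s into
     Re (f, f o D_s) + s P(s) + A = 0,
   and eliminating P yields (s + 1) Re (f, f o D_s) = - A <= 0 for s > 1. Letting
   s -> 1, the strong continuity of dilations in L^2 forces f = 0. Thus u is
   independent of x_n, which for a function in L^2 means u = 0. *)

Require Import Defs.
From HB Require Import structures.
From mathcomp Require Import all_boot all_order all_algebra.
From mathcomp Require Import complex ring lra.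
From mathcomp Require Import all_classical all_reals all_analysis measurable_realfun.
Import Order.TTheory GRing.Theory Num.Theory.
Import numFieldNormedType.Exports.
Local Open Scope classical_set_scope.
Local Open Scope ring_scope.
Local Open Scope complex_scope.

Set Implicit Arguments.
Unset Strict Implicit.
Unset Printing Implicit Defensive.

(** The infinitesimal form of the argument would test with x_n D_n u, which for a general u in H^1
    does not lie in H^1; a finite dilation keeps u o D_s in the form domain. The price is a sign
    problem: P(s) collects the tangential energy and the eigenvalue term, neither of which has a
    usable sign for fixed s. Pairing s with 1/s removes it, since both terms scale by the same
    factor s under inversion, while the normal term also carries the chain-rule factor. A single
    object feeds the analytic steps: the sequence of test functions by which [is_trace] witnesses
    the trace of u. Composed with D_s it witnesses the trace of u o D_s. Its normal derivatives are
    continuous approximants of f = D_n u, to which Fatou's lemma applies, and this gives the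
    continuity of dilations at f. Its compact supports replace the behaviour of u at infinity when f
    = 0 is turned into u = 0. *)

(** By uniqueness of Lebesgue measure: s times the pushforward under multiplication by s gives every
    interval ]a, b] its length. *)
Lemma lebesgue_measure_preimage_scale {R : realType} (s : R) (A : set R) :
  0 < s -> measurable A ->
  lebesgue_measure (( *%R s) @^-1` A) = ((s^-1)%:E * lebesgue_measure A)%E.
Proof.
move=> s0 mA.
have ms : measurable_fun [set: measurableTypeR R] ( *%R s : _ -> measurableTypeR R).
  exact: measurable_funM.
pose mu : {measure set (measurableTypeR R) -> \bar R} :=
  measure_function_pushforward__canonical__measure_function_Measure
    (@lebesgue_measure R) ms.
have s0' : 0 <= s by exact: ltW.
have H X : ocitv X -> lebesgue_measure X = mscale (NngNum s0') mu X.
  move=> [[a b] ab <-].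
  rewrite /= /mscale /= /pushforward.
  have -> : [eta *%R s] @^-1` `]a, b]%classic = `]a / s, b / s]%classic.
    apply/seteqP; split=> x /=; rewrite !in_itv/=;
    by rewrite ler_pdivlMr // ltr_pdivrMr // ![_ * s]mulrC.
  rewrite !lebesgue_measure_itv /= !lte_fin ltr_pM2r ?invr_gt0 //.
  case: ifP => _; last by rewrite mule0.
  by rewrite -!EFinB -EFinM -mulrBl mulrC divfK // gt_eqF.
rewrite (lebesgue_measure_unique H mA).
by rewrite /mscale /= muleA -EFinM mulVf ?gt_eqF// mul1e.
Qed.

Lemma cvg_rV {R : numFieldType} (T : Type) (F : set_system T) {FF : Filter F} n
    (f : T -> 'rV[R]_n) (a : 'rV[R]_n) :
  (forall i, f x ord0 i @[x --> F] --> a ord0 i) -> f x @[x --> F] --> a.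
Proof.
move=> fa A [P aP PA].
have H : F [set x | forall i, P ord0 i (f x ord0 i)].
  by apply: filter_forall => i; exact: (fa i _ (aP ord0 i)).
near=> x; apply: PA => i j; rewrite ord1; move: j.
by near: x.
Unshelve. all: by end_near.
Qed.

(** * Dilations in the last variable *)

Section dilation.
Context {R : realType} {d : nat}.

Definition rV_dil (s : R) (x : 'rV[R]_d.+1) : 'rV[R]_d.+1 :=
  \row_i (if i == ord_max then s * x ord0 i else x ord0 i).

Lemma rV_dil_snoc s (y : 'rV[R]_d) t :
  rV_dil s (rV_snoc y t) = rV_snoc y (s * t).
Proof.
apply/rowP => i; rewrite !mxE.
case: (unliftP ord_max i) => [j ->|->] /=.
  by rewrite eq_sym (negbTE (neq_lift _ _)).
by rewrite eqxx.
Qed.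

Lemma rV_dilM s t x : rV_dil s (rV_dil t x) = rV_dil (s * t) x.
Proof. by apply/rowP => i; rewrite !mxE; case: eqP => // _; rewrite mulrA. Qed.

Lemma rV_dil1 x : rV_dil 1 x = x.
Proof. by apply/rowP => i; rewrite !mxE mul1r; case: eqP. Qed.

Lemma rV_dilK s : s != 0 -> cancel (rV_dil s) (rV_dil s^-1).
Proof. by move=> s0 x; rewrite rV_dilM mulVf// rV_dil1. Qed.

Lemma measurable_rV_dil s : measurable_fun setT (rV_dil s).
Proof.
apply: measurable_fun_rVP => i; under eq_fun do rewrite mxE.
case: eqP => _; last exact: measurable_rV_coord.
by apply: measurable_funM => //; exact: measurable_rV_coord.
Qed.

Lemma preimage_half_space_dil s : 0 < s ->
  rV_dil s @^-1` half_space = half_space.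
Proof.
by move=> s0; apply/seteqP; split=> x; rewrite /half_space /= mxE eqxx pmulr_rgt0.
Qed.

Lemma half_space_dil s x : 0 < s -> half_space (rV_dil s x) <-> half_space x.
Proof. by move=> s0; rewrite -[X in _ <-> X x](preimage_half_space_dil s0). Qed.

Lemma measurable_half_space : measurable (half_space : set 'rV[R]_d.+1).
Proof.
rewrite (_ : half_space = (fun x : 'rV[R]_d.+1 => x ord0 ord_max) @^-1` `]0, +oo[%classic).
  rewrite -[X in measurable X]setTI.
  exact: (measurable_rV_coord ord_max measurableT (measurable_itv `]0, +oo[)).
by apply/seteqP; split=> x; rewrite /half_space /= in_itv/= andbT.
Qed.

(** The product measure integrates the lengths of vertical sections, and D_s only rescales each
    section, so the one-dimensional scaling law suffices. *)
Lemma lebesgue_rV_dil s (A : set 'rV[R]_d.+1) : 0 < s -> measurable A ->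
  lebesgue_rV d.+1 (rV_dil s @^-1` A) = ((s^-1)%:E * lebesgue_rV d.+1 A)%E.
Proof.
move=> s0 mA; rewrite /= /pushforward.
rewrite /product_measure1 /=.
have mB : measurable ((fun p : 'rV[R]_d * measurableTypeR R =>
    rV_snoc p.1 p.2) @^-1` A).
  by rewrite -[X in measurable X]setTI; exact: (measurable_rV_snoc measurableT).
rewrite -ge0_integralZl//=.
- apply: eq_integral => y _ /=.
  rewrite -lebesgue_measure_preimage_scale//; last exact: measurable_xsection.
  congr (lebesgue_measure _).
  by apply/seteqP; split=> t; rewrite /xsection /= !inE /= rV_dil_snoc.
- exact: measurable_fun_xsection.
- by rewrite lee_fin invr_ge0 ltW.
Qed.

Lemma ge0_integral_dil s (D : set 'rV[R]_d.+1) (f : 'rV[R]_d.+1 -> \bar R) :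
  0 < s -> measurable D -> measurable_fun D f -> (forall x, D x -> 0 <= f x)%E ->
  (\int[lebesgue_rV d.+1]_(x in rV_dil s @^-1` D) f (rV_dil s x) =
   (s^-1)%:E * \int[lebesgue_rV d.+1]_(x in D) f x)%E.
Proof.
move=> s0 mD mf f0.
rewrite -(ge0_integral_pushforward (measurable_rV_dil s))//; last first.
  by move=> x /set_mem; exact: f0.
have s0' : 0 <= s^-1 by rewrite invr_ge0 ltW.
rewrite -[s^-1]/((NngNum s0')%:num) -ge0_integral_mscale//.
apply: (eq_measure_integral _ (m1 :=
  measure_function_pushforward__canonical__measure_function_Measure
    (lebesgue_rV d.+1) (measurable_rV_dil s))) => A mA _.
exact: lebesgue_rV_dil.
Qed.

Lemma Rintegral_dil s (D : set 'rV[R]_d.+1) (f : 'rV[R]_d.+1 -> R) :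
  0 < s -> measurable D -> measurable_fun D f ->
  \int[lebesgue_rV d.+1]_(x in rV_dil s @^-1` D) f (rV_dil s x) =
  s^-1 * \int[lebesgue_rV d.+1]_(x in D) f x.
Proof.
move=> s0 mD mf; rewrite /Rintegral integralE [in RHS]integralE.
have mf' : measurable_fun D (EFin \o f) by exact/measurable_EFinP.
have HP := ge0_integral_dil s0 mD (measurable_funepos mf') (fun x _ => funepos_ge0 _ x).
have HN := ge0_integral_dil s0 mD (measurable_funeneg mf') (fun x _ => funeneg_ge0 _ x).
have P0 : (0 <= \int[lebesgue_rV d.+1]_(x in D) (EFin \o f)^\+%E x)%E by exact: integral_ge0.
have N0 : (0 <= \int[lebesgue_rV d.+1]_(x in D) (EFin \o f)^\-%E x)%E by exact: integral_ge0.
set P := (X in fine (X - _)%E = _); set N := (X in fine (_ - X)%E = _).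
rewrite (etrans (_ : P = _) HP); last first.
  by apply: eq_integral => x _; rewrite !funeposE.
rewrite (etrans (_ : N = _) HN); last first.
  by apply: eq_integral => x _; rewrite !funenegE.
rewrite {P N HP HN} -/(EFin \o f).
move: P0 N0.
have s0' : (0 < (s^-1)%:E)%E by rewrite lte_fin invr_gt0.
(* If the positive or the negative part has infinite integral, the positive factor keeps it
   infinite, and [fine] sends both sides to 0. *)
case: (integral _ _ _) => [a||] //; case: (integral _ _ _) => [b||] // _ _.
- by rewrite -!EFinM -!EFinB /= mulrBr.
- by rewrite gt0_muley//= mulr0.
- by rewrite gt0_muley//= mulr0.
- by rewrite gt0_muley//= mulr0.
Qed.

Lemma ge0_integral_half_space_dil s (f : 'rV[R]_d.+1 -> \bar R) :
  0 < s -> measurable_fun half_space f ->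
  (forall x, half_space x -> 0 <= f x)%E ->
  (\int[lebesgue_rV d.+1]_(x in half_space) f (rV_dil s x) =
   (s^-1)%:E * \int[lebesgue_rV d.+1]_(x in half_space) f x)%E.
Proof.
move=> s0 mf f0; rewrite -ge0_integral_dil// ?preimage_half_space_dil//.
exact: measurable_half_space.
Qed.

Lemma Rintegral_half_space_dil s (f : 'rV[R]_d.+1 -> R) :
  0 < s -> measurable_fun half_space f ->
  \int[lebesgue_rV d.+1]_(x in half_space) f (rV_dil s x) =
   s^-1 * \int[lebesgue_rV d.+1]_(x in half_space) f x.
Proof.
move=> s0 mf; rewrite -Rintegral_dil// ?preimage_half_space_dil//.
exact: measurable_half_space.
Qed.

Lemma measurable_half_space_dil s d' (T : measurableType d')
    (f : 'rV[R]_d.+1 -> T) : 0 < s ->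
  measurable_fun half_space f -> measurable_fun half_space (f \o rV_dil s).
Proof.
move=> s0 mf; apply: (measurable_comp measurable_half_space _ mf).
  by move=> _ [x xU <-]; exact/half_space_dil.
by apply: measurable_funTS; exact: measurable_rV_dil.
Qed.

Lemma continuous_rV_dil s : continuous (rV_dil s : _ -> 'rV[R]_d.+1).
Proof.
move=> x; apply: (@cvg_rV _ _ (nbhs x) _) => i; under eq_fun do rewrite mxE.
rewrite mxE; case: eqP => _; last exact: coord_continuous.
by apply: cvgM; [exact: cvg_cst|exact: coord_continuous].
Qed.

End dilation.

(* [f] is the limit of its values at the points of the grids of mesh [1 / m]. *)
Lemma measurable_continuous_rV {R : realType} n (f : 'rV[R]_n -> R) :
  continuous f -> measurable_fun setT f.
Proof.
move=> cf.
pose z m (x : 'rV[R]_n) : 'rV[int]_n := \row_i Num.floor (m.+1%:R * x ord0 i).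
pose r m (k : 'rV[int]_n) : 'rV[R]_n := \row_i ((k ord0 i)%:~R / m.+1%:R).
apply: (@measurable_fun_cvg _ _ _ _ (fun m => f \o r m \o z m)) => [m|x _].
  move=> _ Y mY; rewrite setTI.
  (* [S k] is the grid cell with corner [r m k], or empty when f at that corner is outside Y. There
     are countably many indices k, so the preimage is a countable union of boxes. *)
  pose S (k : 'rV[int]_n) : set 'rV[R]_n := [set x | f (r m k) \in Y /\ forall i,
    x ord0 i \in `[(k ord0 i)%:~R / m.+1%:R, ((k ord0 i)%:~R + 1) / m.+1%:R[].
  have -> : (f \o r m \o z m) @^-1` Y = \bigcup_k S k.
    apply/seteqP; split=> x /=.
      move=> fx; exists (z m x) => //; split; first by rewrite inE.
      move=> i; rewrite !mxE in_itv/= ler_pdivrMr// ltr_pdivlMr// mulrC.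
      by rewrite floor_le /= -intrD1 floorD1_gt.
    move=> [k _ /= [fk xk]]; have -> : z m x = k; last by move: fk; rewrite inE.
    apply/rowP => i; rewrite mxE; apply: floor_def.
    by have := xk i; rewrite in_itv/= ler_pdivrMr// ltr_pdivlMr// mulrC intrD.
  apply: countable_bigcupT_measurable; first exact: countableP.
  move=> k; case: (boolP (f (r m k) \in Y)) => fY; last first.
    have -> : S k = set0 by apply/seteqP; split=> x //= -[] /(negP fY).
    by [].
  have -> : S k = \bigcap_(i in [set: 'I_n])
     ((fun x : 'rV[R]_n => x ord0 i) @^-1`
     `[(k ord0 i)%:~R / m.+1%:R, ((k ord0 i)%:~R + 1) / m.+1%:R[%classic).
    apply/seteqP; split => x /=; first by move=> [_ xi] i _; exact: xi.
    by move=> xi; split=> // i; exact: xi.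
  apply: fin_bigcap_measurable; first exact: finite_finset.
  move=> i _; rewrite -[X in measurable X]setTI.
  exact: (measurable_rV_coord i measurableT (measurable_itv _)).
apply: (@continuous_cvg _ _ _ \oo _ (fun m => r m (z m x)) f x); first exact: cf.
apply: cvg_rV => i; rewrite /r; under eq_fun do rewrite !mxE.
apply/cvgrPdist_le => e e0.
near=> m.
have m0 : (0 : R) < m.+1%:R by [].
set t := m.+1%:R * x ord0 i.
have -> : x ord0 i = t / m.+1%:R by rewrite /t mulrC mulKf ?gt_eqF.
rewrite -mulrBl normrM ger0_norm ?subr_ge0 ?floor_le// gtr0_norm ?invr_gt0//.
apply: (@le_trans _ _ (harmonic m)).
  rewrite /harmonic -[leRHS]mul1r ler_wpM2r ?invr_ge0//.
  have /andP[_] := floor_itv t; rewrite intrD => /ltW; lra.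
near: m.
have /cvgrPdist_le/(_ e e0) := @cvg_harmonic R.
apply: filterS => m; rewrite sub0r normrN ger0_norm ?harmonic_ge0.
Unshelve. all: by end_near.
Qed.

(** * Dilations of test functions *)

Section directional_derivative.
Context {R : realType} {V : normedModType R}.
Implicit Types (f : V -> R) (x v : V) (a t : R).

(** Both difference quotients are the same function of h. This brings directional derivatives within
    reach of the one-variable chain rule and of the fundamental theorem of calculus. *)
Lemma is_derive_line f x v a t :
  is_derive (t *: v + x) v f a <-> is_derive t 1 (fun h => f (h *: v + x)) a.
Proof.
have E : (fun h : R => h^-1 *: ((f \o shift (t *: v + x)) (h *: v) - f (t *: v + x))) =
    (fun h : R => h^-1 *: (((fun h => f (h *: v + x)) \o shift t) (h *: (1 : R)) -
        f (t *: v + x))).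
  by apply/funext => h; rewrite /= /shift /= addrA -scalerDl [h *: 1]mulr1.
split=> -[df fa].
  by split; [move: df; rewrite /derivable E|move: fa; rewrite /derive E].
by split; [move: df; rewrite /derivable -E|move: fa; rewrite /derive -E].
Qed.

Lemma is_derive_comp_scale f g x y v a (c : R) :
  (forall h, g (h *: v + x) = f ((c * h) *: v + y)) ->
  is_derive y v f a -> is_derive x v g (c * a).
Proof.
move=> gf; rewrite -[y]add0r -(scale0r v) => /is_derive_line df.
rewrite -[x]add0r -(scale0r v); apply/is_derive_line.
have -> : (fun h => g (h *: v + x)) = (fun h => f (h *: v + y)) \o ( *%R c).
  exact/funext.
rewrite mulrC; apply: is_derive1_comp; first by rewrite mulr0.
apply: is_derive_eq; by rewrite [_ *: _]mulr1.
Qed.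

End directional_derivative.

Lemma Ck_continuous {R : realType} n k (f : 'rV[R]_n -> R) :
  Ck k f -> continuous f.
Proof. by case: k => [|k] //= -[]. Qed.

Lemma measurable_partial {R : realType} n (i : 'I_n) (U : set 'rV[R]_n) f :
  test_function U f -> measurable_fun setT (partial i f).
Proof.
by case=> /(_ 1)[_ /(_ i)[_ cf]] _ _; exact: measurable_continuous_rV.
Qed.

Section dilation_test_function.
Context {R : realType} {d : nat}.
Implicit Types (f phi : 'rV[R]_d.+1 -> R) (i : 'I_d.+1) (s : R).

(** The i-th diagonal entry of the linear map [rV_dil s], hence the chain-rule factor of the i-th
    partial derivative. *)
Definition dil_coef s i : R := if i == ord_max then s else 1.

Lemma dil_coefV s i : s != 0 -> dil_coef s i * dil_coef s^-1 i = 1.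
Proof. by move=> s0; rewrite /dil_coef; case: eqP => _; rewrite ?mulr1// mulfV. Qed.

Lemma rV_dil_line s i (h : R) (x : 'rV[R]_d.+1) :
  rV_dil s (h *: delta_mx ord0 i + x) =
  (dil_coef s i * h) *: delta_mx ord0 i + rV_dil s x.
Proof.
apply/rowP => j; rewrite !mxE /dil_coef eqxx /=.
have [->|ji] := eqVneq j i; last by rewrite !mulr0 !add0r.
by rewrite !mulr1; case: eqP => _; rewrite ?mul1r// mulrDr.
Qed.

Lemma is_derive_dil s i f (b : R) x :
  derivable f (rV_dil s x) (delta_mx ord0 i) ->
  is_derive x (delta_mx ord0 i) (fun x => b * f (rV_dil s x))
    (b * dil_coef s i * partial i f (rV_dil s x)).
Proof.
move=> df.
have : is_derive (rV_dil s x) (delta_mx ord0 i) f (partial i f (rV_dil s x)).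
  exact/derivableP.
move=> /(@is_derive_comp_scale _ _ _ (f \o rV_dil s) x) H.
rewrite -mulrA; apply: is_deriveZ; apply: H => h.
by rewrite /= rV_dil_line.
Qed.

(** The factor b makes the induction close: a partial derivative of b f(D_s x) has the same shape,
    with b replaced by [b * dil_coef s i]. *)
Lemma Ck_dil k s (b : R) f : Ck k f -> Ck k (fun x => b * f (rV_dil s x)).
Proof.
have H (b' : R) g : continuous g -> continuous (fun x => b' * g (rV_dil s x)).
  move=> cg x; have cgs : {for x, continuous (g \o rV_dil s)}.
    by apply: continuous_comp; [exact: continuous_rV_dil|exact: cg].
  exact: (cvgM (cvg_cst b') cgs).
elim: k b f => [|k IH] b f.
  exact: H.
move=> [cf Df]; split.
  exact: H.
move=> i; have [df Ckf] := Df i; split=> [x|].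
  by have [] := is_derive_dil b (df (rV_dil s x)).
have -> : partial i (fun x => b * f (rV_dil s x)) =
    fun x => b * dil_coef s i * partial i f (rV_dil s x).
  by apply/funext => x; have [] := is_derive_dil b (df (rV_dil s x)).
exact: IH.
Qed.

Lemma partial_dil s i f x : Ck 1 f ->
  partial i (f \o rV_dil s) x = dil_coef s i * partial i f (rV_dil s x).
Proof.
move=> [_ /(_ i)[df _]]; have [_] := is_derive_dil 1 (df (rV_dil s x)).
rewrite mul1r => <-; congr ('D_ _ _ _).
by apply/funext => y; rewrite /= mul1r.
Qed.

Lemma fsupport_dil s (b : R) f :
  fsupport (fun x => b * f (rV_dil s x)) `<=` rV_dil s @^-1` fsupport f.
Proof.
move=> x xf A Ax.
have [y [/= fy Ay]] := xf _ (continuous_rV_dil Ax).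
exists (rV_dil s y); split=> //=.
by apply: contraNneq fy => ->; rewrite mulr0.
Qed.

Lemma test_function_dil s (b : R) (U : set 'rV[R]_d.+1) phi : s != 0 ->
  test_function U phi ->
  test_function (rV_dil s @^-1` U) (fun x => b * phi (rV_dil s x)).
Proof.
move=> s0 [Cphi cphi sphi]; split.
- by move=> k; exact: Ck_dil.
- apply: (@subclosed_compact _ _ (rV_dil s^-1 @` fsupport phi)).
  + exact: closed_closure.
  + apply: continuous_compact => //.
    by apply: continuous_subspaceT; exact: continuous_rV_dil.
  + by move=> x /fsupport_dil xf; exists (rV_dil s x) => //; exact: rV_dilK.
- by move=> x /fsupport_dil /sphi.
Qed.

End dilation_test_function.

(** * Square integrable functions *)

Lemma Rintegral_sum d (T : measurableType d) {R : realType}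
    (mu : {measure set T -> \bar R}) (U : set T) (I : Type) (r : seq I)
    (f : I -> T -> R) :
  measurable U -> (forall i, mu.-integrable U (EFin \o f i)) ->
  \int[mu]_(x in U) (\sum_(i <- r) f i x) = \sum_(i <- r) \int[mu]_(x in U) f i x.
Proof.
move=> mU fi; elim: r => [|i r IH].
  rewrite big_nil; under eq_Rintegral do rewrite big_nil.
  by rewrite /Rintegral integral0.
rewrite big_cons -IH -RintegralD//.
  by apply: eq_Rintegral => x _; rewrite big_cons.
have H : mu.-integrable U (fun x => \sum_(i <- r) (EFin \o f i) x)%E.
  exact: integrable_sum.
by apply: eq_integrable H => // x _; rewrite /= sumEFin.
Qed.

Section square_integrable.
Context d (T : measurableType d) {R : realType} (mu : {measure set T -> \bar R})
  (U : set T) (mU : measurable U).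
Implicit Types (f g h : T -> R) (a : R).

Definition square_integrable f :=
  measurable_fun U f /\ mu.-integrable U (EFin \o (fun x => f x ^+ 2)).

(** The real inner product: the real part of a complex one is the sum of the [dotL2] of the real
    parts and the [dotL2] of the imaginary parts. *)
Definition dotL2 f g := \int[mu]_(x in U) (f x * g x).
Definition sqL2 f := \int[mu]_(x in U) (f x ^+ 2).

Lemma LnormE_sq f :
  (Lnorm mu 2%:E (EFin \o (f \_ U)) `^ 2 = \int[mu]_(x in U) (f x ^+ 2)%:E)%E.
Proof.
rewrite poweR_Lnorm//= [RHS]integral_mkcond.
apply: eq_integral => x _; rewrite /= !patchE; case: ifPn => _.
  by rewrite powR_mulrn// -normrX ger0_norm ?sqr_ge0.
by rewrite normr0 powR0.
Qed.

Lemma square_integrableP f :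
  f \_ U \in Lfun mu 2%:E <-> square_integrable f.
Proof.
split.
  move=> fL; have /andP[] := fL; rewrite inE /= => mf _.
  have mf' : measurable_fun U f by apply/measurable_restrictT.
  split=> //; have := Lfun2_integrable_sqr fL.
  move/(integrableS measurableT mU (@subsetT _ _)).
  by apply: eq_integrable => // x xU; rewrite /= patchE xU.
move=> [mf /integrableP[mf2 fi]]; apply/andP; split; rewrite inE /=.
  by apply/(measurable_restrictT f mU).
rewrite /finite_norm; apply: (@lty_poweRy _ _ 2) => //.
rewrite LnormE_sq; move: fi; congr (_ < _)%E; apply: eq_integral => x _ /=.
by rewrite ger0_norm ?sqr_ge0.
Qed.

Lemma square_integrable_mul f g : square_integrable f -> square_integrable g ->
  mu.-integrable U (EFin \o (fun x => f x * g x)).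
Proof.
move=> [mf fi] [mg gi]; have := integrableD mU fi gi.
apply: le_integrable => //.
  by apply/measurable_EFinP; exact: measurable_funM.
move=> x _; have h : 0 <= f x ^+ 2 + g x ^+ 2 by rewrite addr_ge0 ?sqr_ge0.
by rewrite /= lee_fin (ger0_norm h) ler_norml; apply/andP; split; nra.
Qed.

Lemma square_integrableD f g : square_integrable f -> square_integrable g ->
  square_integrable (f \+ g).
Proof.
move=> Sf Sg; have [mf fi] := Sf; have [mg gi] := Sg.
split; first exact: measurable_funD.
have H := integrableD mU (integrableZl mU 2 fi) (integrableZl mU 2 gi).
apply: (le_integrable mU _ _ H).
  by apply/measurable_EFinP; apply: measurable_funX; exact: measurable_funD.
move=> x _ /=; rewrite lee_fin !ger0_norm ?sqr_ge0//; last first.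
  by rewrite addr_ge0// mulr_ge0// sqr_ge0.
by have := sqr_ge0 (f x - g x); nra.
Qed.

Lemma square_integrableZ a f : square_integrable f ->
  square_integrable (fun x => a * f x).
Proof.
move=> [mf fi]; split; first exact: measurable_funM.
have := integrableZl mU (a ^+ 2) fi.
by apply: eq_integrable => // x _ /=; rewrite -EFinM exprMn.
Qed.

Lemma square_integrableB f g : square_integrable f -> square_integrable g ->
  square_integrable (f \- g).
Proof.
move=> Sf /(square_integrableZ (-1)) Sg; have := square_integrableD Sf Sg.
by congr square_integrable; apply/funext => x /=; rewrite mulN1r.
Qed.

Lemma dotL2C f g : dotL2 f g = dotL2 g f.
Proof. by apply: eq_Rintegral => x _; rewrite mulrC. Qed.

Lemma dotL2Dl f g h : square_integrable f -> square_integrable g ->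
  square_integrable h -> dotL2 (f \+ g) h = dotL2 f h + dotL2 g h.
Proof.
move=> Sf Sg Sh; rewrite /dotL2 -RintegralD//; last 2 first.
- exact: square_integrable_mul.
- exact: square_integrable_mul.
by apply: eq_Rintegral => x _ /=; rewrite mulrDl.
Qed.

Lemma dotL2Zl a f h : square_integrable f -> square_integrable h ->
  dotL2 (fun x => a * f x) h = a * dotL2 f h.
Proof.
move=> Sf Sh; rewrite /dotL2 -RintegralZl//; last exact: square_integrable_mul.
by apply: eq_Rintegral => x _; rewrite mulrA.
Qed.

Lemma dotL2Zr a f h : square_integrable f -> square_integrable h ->
  dotL2 f (fun x => a * h x) = a * dotL2 f h.
Proof. by move=> Sf Sh; rewrite dotL2C dotL2Zl// dotL2C. Qed.

Lemma sqL2E f : sqL2 f = dotL2 f f.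
Proof. by apply: eq_Rintegral => x _; rewrite expr2. Qed.

Lemma sqL2_ge0 f : 0 <= sqL2 f.
Proof. by apply: Rintegral_ge0 => x _; exact: sqr_ge0. Qed.

Lemma sqL2Z a f : square_integrable f -> sqL2 (fun x => a * f x) = a ^+ 2 * sqL2 f.
Proof.
move=> Sf; rewrite !sqL2E dotL2Zl//; last exact: square_integrableZ.
by rewrite dotL2C dotL2Zl// mulrA expr2.
Qed.

Lemma sqL2D f g : square_integrable f -> square_integrable g ->
  sqL2 (f \+ g) = sqL2 f + 2 * dotL2 f g + sqL2 g.
Proof.
move=> Sf Sg; have Sfg := square_integrableD Sf Sg.
rewrite !sqL2E dotL2Dl// dotL2C [dotL2 g _]dotL2C !dotL2Dl//.
by rewrite (dotL2C g f); ring.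
Qed.

Lemma sqL2B f g : square_integrable f -> square_integrable g ->
  sqL2 (f \- g) = sqL2 f - 2 * dotL2 f g + sqL2 g.
Proof.
move=> Sf Sg; have Sg' := square_integrableZ (-1) Sg.
rewrite (_ : f \- g = f \+ (fun x => -1 * g x)); last first.
  by apply/funext => x /=; rewrite mulN1r.
rewrite sqL2D// sqL2Z// dotL2C dotL2Zl// dotL2C; ring.
Qed.

(** The parallelogram identity with the square of the difference dropped. It serves as a triangle
    inequality for squared norms, without square roots. *)
Lemma sqL2D_le f g : square_integrable f -> square_integrable g ->
  sqL2 (f \+ g) <= 2 * sqL2 f + 2 * sqL2 g.
Proof.
move=> Sf Sg; have := sqL2_ge0 (f \- g); rewrite sqL2B// sqL2D//; lra.
Qed.

Lemma sqL2_EFin f : square_integrable f ->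
  (sqL2 f)%:E = (\int[mu]_(x in U) (f x ^+ 2)%:E)%E.
Proof. by move=> [_ fi]; rewrite /sqL2 /Rintegral fineK//; exact: integrable_fin_num. Qed.

Lemma sqL2_eq0 f : square_integrable f -> sqL2 f = 0 ->
  {ae mu, forall x, U x -> f x = 0}.
Proof.
move=> Sf f0; have [mf fi] := Sf.
have mf2 : measurable_fun U (EFin \o (fun x => f x ^+ 2)).
  by apply/measurable_EFinP; exact: measurable_funX.
have : (\int[mu]_(x in U) `|(EFin \o (fun x => (f x ^+ 2)%R)) x| = 0)%E.
  transitivity (sqL2 f)%:E; last by rewrite f0.
  rewrite sqL2_EFin//; apply: eq_integral => x _ /=.
  by rewrite ger0_norm ?sqr_ge0.
move=> /(ae_eq_integral_abs mu mU mf2).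
apply: filterS => x /= /[apply] -[] /eqP.
by rewrite sqrf_eq0 => /eqP.
Qed.

End square_integrable.

Lemma Lp_measurable {R : realType} n (U : set 'rV[R]_n) p (f : 'rV[R]_n -> R) :
  measurable U -> Lp U p f -> measurable_fun U f.
Proof.
by move=> mU /andP[]; rewrite inE /= => mf _; exact/(measurable_restrictT f mU).
Qed.

(** * Complex-valued functions and convergence in L^2 *)

Section complex_parts.
Context {R : realType}.

Lemma ReD (z w : R[i]) : complex.Re (z + w) = complex.Re z + complex.Re w.
Proof. by case: z; case: w. Qed.

Lemma ImD (z w : R[i]) : complex.Im (z + w) = complex.Im z + complex.Im w.
Proof. by case: z; case: w. Qed.

Lemma ReB (z w : R[i]) :
  complex.Re (z - w) = complex.Re z - complex.Re w.
Proof. by case: z; case: w. Qed.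

Lemma ImB (z w : R[i]) :
  complex.Im (z - w) = complex.Im z - complex.Im w.
Proof. by case: z; case: w. Qed.

Lemma ReZ (c : R) (z : R[i]) : complex.Re (c%:C * z) = c * complex.Re z.
Proof. by case: z => a b /=; rewrite mul0r subr0. Qed.

Lemma ImZ (c : R) (z : R[i]) : complex.Im (c%:C * z) = c * complex.Im z.
Proof. by case: z => a b /=; rewrite mul0r addr0. Qed.

Lemma Re_mulconj (z w : R[i]) : complex.Re (z * w^*) =
  complex.Re z * complex.Re w + complex.Im z * complex.Im w.
Proof. by case: z => a b; case: w => a' b' /=; ring. Qed.

Lemma Im_mulconj_self (z : R[i]) : complex.Im (z * z^*) = 0.
Proof. by case: z => a b /=; ring. Qed.

Lemma Re_sum (I : Type) (r : seq I) (P : pred I) (F : I -> R[i]) :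
  complex.Re (\sum_(i <- r | P i) F i) = \sum_(i <- r | P i) complex.Re (F i).
Proof. exact: (big_morph (@complex.Re R) ReD). Qed.

Lemma Im_sum (I : Type) (r : seq I) (P : pred I) (F : I -> R[i]) :
  complex.Im (\sum_(i <- r | P i) F i) = \sum_(i <- r | P i) complex.Im (F i).
Proof. exact: (big_morph (@complex.Im R) ImD). Qed.

Lemma normc_sqr (z : R[i]) :
  Normc.normc z ^+ 2 = complex.Re z ^+ 2 + complex.Im z ^+ 2.
Proof. by case: z => a b /=; rewrite sqr_sqrtr// addr_ge0 ?sqr_ge0. Qed.

End complex_parts.

(** Norms are extended reals and may be infinite for finitely many k; the right-hand side only
    constrains large k. *)
Lemma cvge0P {R : realType} (u : nat -> \bar R) : (forall k, 0 <= u k)%E ->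
  u k @[k --> \oo] --> 0%E <->
  forall e : R, 0 < e -> \forall k \near \oo, (u k <= e%:E)%E.
Proof.
move=> u0; split=> [/fine_cvgP[fu uc] e e0|ue].
  have /cvgrPdist_le/(_ e e0) := uc; move: fu; apply: filterS2 => k fk.
  rewrite sub0r normrN /= ger0_norm ?fine_ge0//.
  by rewrite -lee_fin fineK.
apply/fine_cvgP; split.
  by apply: filterS (ue 1 ltr01) => k uk; rewrite ge0_fin_numE// (le_lt_trans uk) ?ltry.
apply/cvgrPdist_le => e e0; apply: filterS (ue e e0) => k uk.
rewrite sub0r normrN /= ger0_norm ?fine_ge0//.
by rewrite -lee_fin fineK// ge0_fin_numE// (le_lt_trans uk) ?ltry.
Qed.

Lemma measurable_normcB_sqr {R : realType} d (T : measurableType d) (U : set T)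
    (f g : T -> R[i]) :
  measurable_fun U (ReF f) -> measurable_fun U (ImF f) ->
  measurable_fun U (ReF g) -> measurable_fun U (ImF g) ->
  measurable_fun U (fun x => Normc.normc (f x - g x) ^+ 2).
Proof.
move=> mRf mIf mRg mIg; under eq_fun do rewrite normc_sqr ReB ImB.
by apply: measurable_funD; apply: measurable_funX; exact: measurable_funB.
Qed.

Lemma poweR2_le {R : realType} (x : \bar R) (e : R) : (0 <= x)%E -> 0 < e ->
  (x `^ 2 <= (e ^+ 2)%:E)%E = (x <= e%:E)%E.
Proof.
move=> x0 e0; case: x x0 => [r||] // r0; last by rewrite poweRyr// !leye_eq.
by rewrite /= powR_mulrn// !lee_fin ler_sqr// nnegrE ltW.
Qed.

Lemma cvg_L2P {R : realType} n (U : set 'rV[R]_n) (f_ : nat -> 'rV[R]_n -> R[i]) f :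
  cvg_L2 U f_ f <-> forall e : R, 0 < e -> \forall k \near \oo,
    (\int[lebesgue_rV n]_(x in U) (Normc.normc (f_ k x - f x) ^+ 2)%:E <= e%:E)%E.
Proof.
split.
  move=> /cvge0P H e e0.
  have : 0 < Num.sqrt e by rewrite sqrtr_gt0.
  move=> /H{H}; move=> /(_ (fun k => Lnorm_ge0 _ _ _)).
  apply: filterS => k Hk.
  have <- : Num.sqrt e ^+ 2 = e by rewrite sqr_sqrtr ?ltW.
  by rewrite -LnormE_sq poweR2_le ?sqrtr_gt0// Lnorm_ge0.
move=> H; apply/cvge0P => [k|e e0]; first exact: Lnorm_ge0.
have := H _ (exprn_gt0 2 e0); apply: filterS => k.
by rewrite -LnormE_sq poweR2_le// Lnorm_ge0.
Qed.

(** Square integrability of the differences is extracted from the convergence: for large k the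
    integral of |f_k - f|^2 is finite, and it dominates the squares of the real and imaginary
    parts. *)
Lemma cvg_L2_parts {R : realType} n (U : set 'rV[R]_n)
    (f_ : nat -> 'rV[R]_n -> R[i]) f : measurable U ->
  (forall k, measurable_fun U (ReF (f_ k)) /\ measurable_fun U (ImF (f_ k))) ->
  L2 U f -> cvg_L2 U f_ f ->
  forall e : R, 0 < e -> \forall k \near \oo,
   [/\ square_integrable (lebesgue_rV n) U (ReF (f_ k) \- ReF f),
       square_integrable (lebesgue_rV n) U (ImF (f_ k) \- ImF f),
       sqL2 (lebesgue_rV n) U (ReF (f_ k) \- ReF f) <= e &
       sqL2 (lebesgue_rV n) U (ImF (f_ k) \- ImF f) <= e].
Proof.
move=> mU mf_ [/(square_integrableP _ mU)[mRf _] /(square_integrableP _ mU)[mIf _]].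
move=> /cvg_L2P H e e0; apply: filterS (H e e0) => k {}H.
have [mRk mIk] := mf_ k.
have key (g : 'rV[R]_n -> R) : measurable_fun U g ->
  (forall x, U x -> g x ^+ 2 <= Normc.normc (f_ k x - f x) ^+ 2) ->
  square_integrable (lebesgue_rV n) U g /\ sqL2 (lebesgue_rV n) U g <= e.
  move=> mg gle.
  have le1 : (\int[lebesgue_rV n]_(x in U) (g x ^+ 2)%:E <= e%:E)%E.
    apply: le_trans H; apply: ge0_le_integral => //.
    - by move=> x _; rewrite lee_fin sqr_ge0.
    - by apply/measurable_EFinP; exact: measurable_funX.
    - by apply/measurable_EFinP; exact: measurable_normcB_sqr.
  have Sg : square_integrable (lebesgue_rV n) U g.
    split=> //; apply/integrableP; split.
      by apply/measurable_EFinP; exact: measurable_funX.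
    apply: le_lt_trans (ltry e); apply: le_trans le1.
    rewrite le_eqVlt; apply/orP; left; apply/eqP; apply: eq_integral => x _ /=.
    by rewrite ger0_norm ?sqr_ge0.
  by split=> //; rewrite -lee_fin sqL2_EFin.
have [||SR SR'] := key (ReF (f_ k) \- ReF f).
- exact: measurable_funB.
- by move=> x _; rewrite normc_sqr ReB ImB lerDl sqr_ge0.
have [||SI SI'] := key (ImF (f_ k) \- ImF f).
- exact: measurable_funB.
- by move=> x _; rewrite normc_sqr ReB ImB lerDr sqr_ge0.
by [].
Qed.

(** * Tonelli's theorem on R^(n+1) *)

Section lebesgue_rV_tonelli.
Context {R : realType}.

Definition rV_box n (k : nat) : set 'rV[R]_n :=
  [set x | forall i, x ord0 i \in `[- k%:R, k%:R]].

Arguments rV_box : clear implicits.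

Lemma rV_snoc_max n (y : 'rV[R]_n) t : rV_snoc y t ord0 ord_max = t.
Proof. by rewrite mxE unlift_none. Qed.

Lemma rV_snoc_lift n (y : 'rV[R]_n) t i :
  rV_snoc y t ord0 (lift ord_max i) = y ord0 i.
Proof. by rewrite mxE liftK. Qed.

Lemma measurable_rV_box n k : measurable (rV_box n k).
Proof.
have -> : rV_box n k = \bigcap_(i in [set: 'I_n])
    ((fun x : 'rV[R]_n => x ord0 i) @^-1` `[- k%:R, k%:R]%classic).
  by apply/seteqP; split => [x xk i _|x xk i]; [exact: xk|exact: xk].
apply: fin_bigcap_measurable; first exact: finite_finset.
move=> i _; rewrite -[X in measurable X]setTI.
exact: (measurable_rV_coord i measurableT (measurable_itv _)).
Qed.

Lemma lebesgue_rV_box n k : (lebesgue_rV n (rV_box n k) < +oo)%E.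
Proof.
elim: n => [|n IH] /=.
  by rewrite diracE; case: (_ \in _); rewrite ltry.
rewrite /pushforward.
have -> : (fun p : 'rV[R]_n * measurableTypeR R => rV_snoc p.1 p.2) @^-1` rV_box n.+1 k
    = rV_box n k `*` `[- k%:R, k%:R]%classic.
  apply/seteqP; split => [[y t] /= xk|[y t] /= [yk tk] i].
    split=> [i|]; first by have := xk (lift ord_max i); rewrite rV_snoc_lift.
    by have := xk ord_max; rewrite rV_snoc_max.
  by case: (unliftP ord_max i) => [j ->|->]; rewrite ?rV_snoc_lift ?rV_snoc_max.
rewrite product_measure1E//; last exact: measurable_rV_box.
have I : (lebesgue_measure (`[(- k%:R)%R, k%:R%R]%classic : set R) < +oo)%E.
  by rewrite lebesgue_measure_itv/=; case: ifP => _; rewrite -?EFinB ltry.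
by apply: lte_mul_pinfty => //; rewrite ge0_fin_numE.
Qed.

(** Needed for Tonelli's theorem; the cubes [rV_box n k] have finite measure and exhaust the
    space. *)
Lemma sigma_finite_lebesgue_rV n : sigma_finite setT (lebesgue_rV (R := R) n).
Proof.
exists (rV_box n) => [|k]; last first.
  by split; [exact: measurable_rV_box|exact: lebesgue_rV_box].
apply/seteqP; split=> // x _; exists (Num.truncn `|x|).+1 => // i.
have xi : `|x ord0 i| <= `|x|.
  rewrite [leRHS](mx_normrE x).
  exact: (le_bigmax _ (fun i => `|x i.1 i.2|) (ord0, i)).
rewrite in_itv/= -ler_norml; apply: (le_trans xi).
exact/ltW/truncnS_gt.
Qed.

Lemma integral_lebesgue_rV_snoc n (f : 'rV[R]_n.+1 -> \bar R) :
  measurable_fun setT f -> (forall x, 0 <= f x)%E ->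
  (\int[lebesgue_rV n.+1]_x f x =
   \int[lebesgue_rV n]_y \int[lebesgue_measure]_t f (rV_snoc y t))%E.
Proof.
move=> mf f0.
have -> : lebesgue_rV n.+1 = rV_snoc_measure (lebesgue_rV n) by [].
rewrite [LHS](ge0_integral_pushforward (measurable_rV_snoc (n := n)))// preimage_setT.
have sf := sigma_finite_lebesgue_rV n.
(* Tonelli's theorem expects a bundled sigma-finite measure, whereas [lebesgue_rV n] is bundled as a
   plain measure; the structure is rebuilt on it. *)
pose m1 : {sigma_finite_measure set 'rV[R]_n -> \bar R} :=
  HB.pack (Measure.sort (lebesgue_rV n))
    (isSFinite.Build _ _ _ (lebesgue_rV n) (sfinite_measure_sigma_finite sf))
    (isSigmaFinite.Build _ _ _ (lebesgue_rV n) sf).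
have mfs : measurable_fun setT
    (f \o (fun p : 'rV[R]_n * measurableTypeR R => rV_snoc p.1 p.2)).
  by apply: measurableT_comp => //; exact: measurable_rV_snoc.
exact: (fubini_tonelli1 (m1 := m1) _ mfs (fun p => f0 (rV_snoc p.1 p.2))).
Qed.

Lemma measurable_integral_snoc n (f : 'rV[R]_n.+1 -> \bar R) :
  measurable_fun setT f -> (forall x, 0 <= f x)%E ->
  measurable_fun setT (fun y => \int[lebesgue_measure]_t f (rV_snoc y t))%E.
Proof.
move=> mf f0.
have mfs : measurable_fun setT
    (f \o (fun p : 'rV[R]_n * measurableTypeR R => rV_snoc p.1 p.2)).
  by apply: measurableT_comp => //; exact: measurable_rV_snoc.
exact: (measurable_fun_fubini_tonelli_F (m2 := lebesgue_measure) _ mfs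
  (fun p => f0 (rV_snoc p.1 p.2))).
Qed.

End lebesgue_rV_tonelli.

(* When inferring the measure of an integral, unification would otherwise unfold
   [lebesgue_rV d.+1] into a pushforward and leave its measurability proof open. *)
#[local] Opaque lebesgue_rV.

(** * Dilations in L^2 and H^1 *)

Lemma cvg_L2_dil {R : realType} d (f_ : nat -> 'rV[R]_d.+1 -> R[i]) f (c s : R) :
  0 < s ->
  (forall k, measurable_fun half_space (ReF (f_ k)) /\
             measurable_fun half_space (ImF (f_ k))) ->
  L2 half_space f -> cvg_L2 half_space f_ f ->
  cvg_L2 half_space (fun k x => c%:C * f_ k (rV_dil s x))
    (fun x => c%:C * f (rV_dil s x)).
Proof.
have mU := @measurable_half_space R d.
move=> s0 mf_ [/(square_integrableP _ mU)[mRf _] /(square_integrableP _ mU)[mIf _]].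
move=> /cvg_L2P H; apply/cvg_L2P => e e0.
(* The change of variables multiplies the squared distance by c^2 / s; adding 1 keeps the divisor
   positive when c = 0. *)
have K0 : 0 < c ^+ 2 * s^-1 + 1 by rewrite ltr_wpDl// mulr_ge0 ?sqr_ge0 ?invr_ge0 ?ltW.
apply: filterS (H _ (divr_gt0 e0 K0)) => k {}H.
have [mRk mIk] := mf_ k.
have mg : measurable_fun half_space (fun x => Normc.normc (f_ k x - f x) ^+ 2).
  exact: measurable_normcB_sqr.
under eq_integral => x _.
  rewrite (_ : _ ^+ 2 =
      c ^+ 2 * Normc.normc (f_ k (rV_dil s x) - f (rV_dil s x)) ^+ 2); last first.
    rewrite !normc_sqr; case: (f_ k _) => a b; case: (f _) => a' b' /=; ring.
  rewrite EFinM; over.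
rewrite /= ge0_integralZl//; last 3 first.
- by apply/measurable_EFinP; exact: (measurable_half_space_dil s0 mg).
- by move=> x _; rewrite lee_fin sqr_ge0.
- by rewrite lee_fin sqr_ge0.
rewrite (ge0_integral_half_space_dil
  (f := fun x => (Normc.normc (f_ k x - f x) ^+ 2)%:E) s0)//; last 2 first.
- exact/measurable_EFinP.
- by move=> x _; rewrite lee_fin sqr_ge0.
rewrite muleA -EFinM; apply: (@le_trans _ _
  ((c ^+ 2 / s)%:E * (e / (c ^+ 2 * s^-1 + 1))%:E)%E).
  by apply: lee_wpmul2l => //; rewrite lee_fin mulr_ge0 ?sqr_ge0 ?invr_ge0 ?ltW.
rewrite -EFinM lee_fin mulrCA -[leRHS]mulr1 ler_wpM2l ?ltW//.
by rewrite ltr_pdivrMr// mul1r ltrDl.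
Qed.

Section dilation_L2.
Context {R : realType} {d : nat}.
Let mu := lebesgue_rV (R := R) d.+1.
Implicit Types (f g h : 'rV[R]_d.+1 -> R) (s : R).

Let mU : measurable (half_space : set 'rV[R]_d.+1) := measurable_half_space.
Let Sq := square_integrable mu half_space.
Let dot := dotL2 mu half_space.
Let sq := sqL2 mu half_space.

Lemma dotL2_dil s f g : 0 < s -> Sq f -> Sq g ->
  dot (f \o rV_dil s) (g \o rV_dil s) = s^-1 * dot f g.
Proof.
move=> s0 [mf _] [mg _].
exact: (Rintegral_half_space_dil (f := fun x => f x * g x) s0 (measurable_funM mf mg)).
Qed.

Lemma square_integrable_dil s f : 0 < s -> Sq f -> Sq (f \o rV_dil s).
Proof.
move=> s0 [mf /integrableP[mf2 fi]]; have mfs := measurable_half_space_dil s0 mf.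
split=> //; apply/integrableP; split.
  by apply/measurable_EFinP; exact: measurable_funX.
have := @ge0_integral_half_space_dil _ _ s (fun x => `|(f x ^+ 2)%:E|%E) s0.
rewrite -/mu => ->//; last by apply: measurableT_comp.
by apply: lte_mul_pinfty => //; rewrite lee_fin invr_ge0 ltW.
Qed.

Lemma sqL2_dil s f : 0 < s -> Sq f -> sq (f \o rV_dil s) = s^-1 * sq f.
Proof. by move=> s0 Sf; rewrite /sq !sqL2E; exact: dotL2_dil. Qed.

(** Dilation factors tending to 1. A sequence, because Fatou's lemma is about sequences; from above,
    because D_s with s > 1 does not increase the L^2 norm and because the sign of Re (f, f o D_s) is
    known for s > 1. *)
Let r_ (j : nat) : R := 1 + harmonic j.

Let r_gt1 j : 1 < r_ j. Proof. by rewrite /r_ ltrDl harmonic_gt0. Qed.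

Let r_gt0 j : 0 < r_ j. Proof. exact: lt_trans (r_gt1 j). Qed.

(* By Fatou's lemma 4 |h|^2 <= liminf |h + h o D_s|^2; the parallelogram identity
   then gives |h - h o D_s| -> 0 without a dominating function. *)
Lemma sqL2_dil_cvg_continuous h : continuous h -> Sq h ->
  forall e : R, 0 < e ->
    \forall j \near \oo, sq (h \- (h \o rV_dil (r_ j))) <= e.
Proof.
move=> ch Sh e e0.
have Shd j : Sq (h \o rV_dil (r_ j)) by exact: square_integrable_dil.
pose u j x := ((h x + h (rV_dil (r_ j) x)) ^+ 2)%:E.
have mu_ j : measurable_fun half_space (u j).
  by apply/measurable_EFinP; apply: measurable_funX; apply: measurable_funD;
    [exact: (Sh.1)|exact: (Shd j).1].
have u0 j x : half_space x -> (0 <= u j x)%E by rewrite lee_fin sqr_ge0.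
have := fatou mu mU mu_ u0.
have -> : (\int[mu]_(x in half_space) limn_einf (u^~ x))%E = (4 * sq h)%:E.
  rewrite (_ : 4 * sq h = sq (fun x => 2 * h x)); last first.
    by rewrite /sq sqL2Z//; congr (_ * _); rewrite expr2; ring.
  rewrite /sq sqL2_EFin//; last exact: square_integrableZ.
  apply: eq_integral => x _.
  suff /cvg_limn_einf_sup[->] : u^~ x @ \oo --> ((2 * h x) ^+ 2)%:E by [].
  apply: cvg_EFin; first exact: nearW.
  rewrite /u /comp /=.
  have H : h (rV_dil (r_ j) x) @[j --> \oo] --> h x.
    apply: (@continuous_cvg _ _ _ \oo _ (fun j => rV_dil (r_ j) x) h x); first exact: ch.
    apply: cvg_rV => i; under eq_fun do rewrite mxE.
    case: eqP => _; last exact: cvg_cst.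
    have hr : r_ j @[j --> \oo] --> (1 + 0 : R).
      exact: (cvgD (cvg_cst _) cvg_harmonic).
    rewrite addr0 in hr.
    have := cvgM hr (cvg_cst (x ord0 i)); rewrite mul1r.
    exact.
  have H2 : h x + h (rV_dil (r_ j) x) @[j --> \oo] --> h x + h x.
    exact: (cvgD (cvg_cst (h x)) H).
  rewrite expr2 mulr_natl mulr2n.
  exact: (cvgM H2 H2).
rewrite limn_einf_lim => le4.
have cv := @ereal_nondecreasing_cvgn _ _
  (nondecreasing_einfs (fun n => \int[mu]_(x in half_space) u n x)%E).
rewrite (cvg_lim _ cv)// in le4.
have lt4 : ((4 * sq h - e)%:E < (4 * sq h)%:E)%E by rewrite lte_fin; lra.
(* The liminf is the supremum of the tail infima, so the tail from some n on stays above 4 |h|^2 -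
   e. *)
have [_ [n _ <-] nh] := ereal_sup_gt (lt_le_trans lt4 le4).
near=> j.
have uj : (4 * sq h - e <= sq (h \+ (h \o rV_dil (r_ j)))).
  rewrite -lee_fin; apply: (le_trans (ltW nh)).
  rewrite /sq sqL2_EFin//; last exact: (square_integrableD mU Sh (Shd j)).
  apply: ereal_inf_lbound; exists j => //=.
  by near: j; exists n.
have ha : sq (h \+ (h \o rV_dil (r_ j))) =
    sq h + 2 * dot h (h \o rV_dil (r_ j)) + sq (h \o rV_dil (r_ j)).
  exact: (sqL2D mU Sh (Shd j)).
have hb : sq (h \- (h \o rV_dil (r_ j))) =
    sq h - 2 * dot h (h \o rV_dil (r_ j)) + sq (h \o rV_dil (r_ j)).
  exact: (sqL2B mU Sh (Shd j)).
have hc : sq (h \o rV_dil (r_ j)) <= sq h.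
  rewrite sqL2_dil// -[leRHS]mul1r ler_wpM2r ?sqL2_ge0//.
  by rewrite invf_le1// ltW.
lra.
Unshelve. all: by end_near.
Qed.

(** Approximation by the continuous [h_ k]: f - f o D splits into h - h o D and the errors -(h - f)
    and (h - f) o D, the latter being no larger than h - f in norm. *)
Lemma sqL2_dil_cvg f (h_ : nat -> 'rV[R]_d.+1 -> R) : Sq f ->
  (forall k, continuous (h_ k)) ->
  (forall e : R, 0 < e -> \forall k \near \oo, Sq (h_ k \- f) /\ sq (h_ k \- f) <= e) ->
  forall e : R, 0 < e -> \forall j \near \oo, sq (f \- (f \o rV_dil (r_ j))) <= e.
Proof.
move=> Sf ch hf e e0.
(* Two uses of [sqL2D_le] give the three terms the weights 2, 4 and 4, and 10/16 < 1. *)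
have e16 : 0 < e / 16 by rewrite divr_gt0.
have [k [Sk sk]] : exists k, Sq (h_ k \- f) /\ sq (h_ k \- f) <= e / 16.
  by have [k _ H] := hf _ e16; exists k; exact: (H k (leqnn k)).
have Sh : Sq (h_ k).
  have := square_integrableD mU Sf Sk; congr square_integrable.
  by apply/funext => x /=; rewrite addrC subrK.
apply: filterS (sqL2_dil_cvg_continuous (ch k) Sh e16) => j hj.
have Skd := square_integrable_dil (r_gt0 j) Sk.
have Shd := square_integrable_dil (r_gt0 j) Sh.
have SB := square_integrableB mU Sh Shd.
have SBC := square_integrableD mU SB Skd.
have SA := square_integrableZ mU (-1) Sk.
have -> : f \- (f \o rV_dil (r_ j)) = (fun x => -1 * (h_ k \- f) x) \+
    ((h_ k \- (h_ k \o rV_dil (r_ j))) \+ ((h_ k \- f) \o rV_dil (r_ j))).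
  by apply/funext => x /=; ring.
apply: (le_trans (sqL2D_le mU SA SBC)).
have := sqL2D_le mU SB Skd; rewrite -/mu -/sq => H.
have := sqL2Z mU (-1) Sk; rewrite -/mu -/sq sqrrN expr1n mul1r => ->.
have : sq ((h_ k \- f) \o rV_dil (r_ j)) <= sq (h_ k \- f).
  rewrite sqL2_dil// -[leRHS]mul1r ler_wpM2r ?sqL2_ge0//.
  by rewrite invf_le1// ltW.
lra.
Qed.

(** Expanding |f - f o D|^2 + |g - g o D|^2, the cross terms contribute nonnegatively, so |f|^2 +
    |g|^2 is at most a quantity tending to 0. The functions f and g stand for the real and imaginary
    parts of D_n u, for which only the sum of correlations has a sign. *)
Lemma sqL2_eq0_of_dil f g (f_ g_ : nat -> 'rV[R]_d.+1 -> R) : Sq f -> Sq g ->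
  (forall k, continuous (f_ k)) -> (forall k, continuous (g_ k)) ->
  (forall e : R, 0 < e -> \forall k \near \oo, Sq (f_ k \- f) /\ sq (f_ k \- f) <= e) ->
  (forall e : R, 0 < e -> \forall k \near \oo, Sq (g_ k \- g) /\ sq (g_ k \- g) <= e) ->
  (forall s, 1 < s -> dot f (f \o rV_dil s) + dot g (g \o rV_dil s) <= 0) ->
  sq f = 0 /\ sq g = 0.
Proof.
move=> Sf Sg cf cg f_f g_g fg.
have f0 := sqL2_ge0 mu half_space f; have g0 := sqL2_ge0 mu half_space g.
suff : sq f + sq g <= 0 by rewrite /sq; split; lra.
apply/ler_addgt0Pr => e e0; rewrite add0r.
have e2 : 0 < e / 2 by rewrite divr_gt0.
have [j _ H] := filterI (sqL2_dil_cvg Sf cf f_f e2) (sqL2_dil_cvg Sg cg g_g e2).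
have [hf hg] := H j (leqnn j).
have := fg _ (r_gt1 j).
have Sfd := square_integrable_dil (r_gt0 j) Sf.
have Sgd := square_integrable_dil (r_gt0 j) Sg.
move: hf hg; rewrite /sq (sqL2B mU Sf Sfd) (sqL2B mU Sg Sgd).
rewrite -/mu -/dot -/sq (sqL2_dil (r_gt0 j) Sf) (sqL2_dil (r_gt0 j) Sg).
have : 0 <= (r_ j)^-1 * sq f by rewrite mulr_ge0 ?invr_ge0// ltW.
have : 0 <= (r_ j)^-1 * sq g by rewrite mulr_ge0 ?invr_ge0// ltW.
lra.
Qed.

End dilation_L2.

Section dilation_H1.
Context {R : realType} {d : nat}.
Implicit Types (f g : 'rV[R]_d.+1 -> R) (s : R) (i : 'I_d.+1).
Implicit Types (u : 'rV[R]_d.+1 -> R[i]) (Du : 'I_d.+1 -> 'rV[R]_d.+1 -> R[i]).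

Let mU : measurable (half_space : set 'rV[R]_d.+1) := measurable_half_space.

Lemma Lp2_dil s (c : R) f : 0 < s -> Lp half_space 2%:E f ->
  Lp half_space 2%:E (fun x => c * f (rV_dil s x)).
Proof.
move=> s0 /(square_integrableP _ mU) Sf; apply/(square_integrableP _ mU).
exact: (square_integrableZ mU c (square_integrable_dil s0 Sf)).
Qed.

(** A change of variables moves the dilation onto the test function; the Jacobian 1/s appears on
    both sides. *)
Lemma weak_partial_dil s i f g : 0 < s ->
  measurable_fun half_space f -> measurable_fun half_space g ->
  weak_partial half_space i f g ->
  weak_partial half_space i (fun x => f (rV_dil s x))
    (fun x => dil_coef s i * g (rV_dil s x)).
Proof.
move=> s0 mf mg fg phi tphi; have s0' : s != 0 by rewrite gt_eqF.
(* chosen so that [partial i psi] o D_s = [partial i phi] *)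
pose psi x := dil_coef s i * phi (rV_dil s^-1 x).
have tpsi : test_function half_space psi.
  have := test_function_dil (dil_coef s i) _ tphi.
  move=> /(_ s^-1); rewrite invr_eq0 => /(_ s0').
  by rewrite preimage_half_space_dil// invr_gt0.
have dpsi x : partial i psi (rV_dil s x) = partial i phi x.
  have [/(_ 1)[_ /(_ i)[dphi _]] _ _] := tphi.
  have [_] := is_derive_dil (dil_coef s i) (dphi (rV_dil s^-1 (rV_dil s x))).
  by rewrite dil_coefV// mul1r rV_dilK.
have mpsi : measurable_fun setT psi.
  by case: tpsi => /(_ 0) cpsi _ _; exact: measurable_continuous_rV.
have mfp : measurable_fun half_space (fun x => f x * partial i psi x).
  apply: measurable_funM => //; apply: measurable_funTS.
  exact: measurable_partial tpsi.
have mgp : measurable_fun half_space (fun x => g x * psi x).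
  by apply: measurable_funM => //; exact: measurable_funTS.
have Ef := Rintegral_half_space_dil s0 mfp.
have Eg := Rintegral_half_space_dil s0 mgp.
rewrite (fg _ tpsi) mulrN -Eg in Ef.
transitivity (- \int[lebesgue_rV d.+1]_(x in half_space)
    (g (rV_dil s x) * psi (rV_dil s x))).
  by rewrite -Ef; apply: eq_Rintegral => x _; rewrite dpsi.
congr (- _); apply: eq_Rintegral => x _; rewrite /psi rV_dilK//; ring.
Qed.

Lemma W1p_dil s f (Df : 'I_d.+1 -> 'rV[R]_d.+1 -> R) : 0 < s ->
  W1p half_space 2%:E f Df ->
  W1p half_space 2%:E (fun x => f (rV_dil s x))
    (fun i x => dil_coef s i * Df i (rV_dil s x)).
Proof.
move=> s0 [Lf LDf]; have [mf _] := (square_integrableP _ mU _).1 Lf.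
split; first by have := Lp2_dil 1 s0 Lf; congr Lp; apply/funext => x; rewrite mul1r.
move=> i; have [LDfi wf] := LDf i; have [mDf _] := (square_integrableP _ mU _).1 LDfi.
by split; [exact: Lp2_dil|exact: weak_partial_dil].
Qed.

Definition grad_dil s Du i x : R[i] := (dil_coef s i)%:C * Du i (rV_dil s x).

Lemma H1_dil s u Du : 0 < s -> H1 half_space u Du ->
  H1 half_space (u \o rV_dil s) (grad_dil s Du).
Proof.
move=> s0 [/(W1p_dil s0) HR /(W1p_dil s0) HI]; split.
- by move: HR; congr W1p; apply/funext => i; apply/funext => x; rewrite /ReF ReZ.
- by move: HI; congr W1p; apply/funext => i; apply/funext => x; rewrite /ImF ImZ.
Qed.

Lemma cpartial_dil s i u : Ck 1 (ReF u) -> Ck 1 (ImF u) ->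
  cpartial i (u \o rV_dil s) = fun x => (dil_coef s i)%:C * cpartial i u (rV_dil s x).
Proof.
move=> CR CI; apply/funext => x; rewrite /cpartial.
have -> := partial_dil s i x CR; have -> := partial_dil s i x CI.
by apply/eqP; rewrite eq_complex /= !mul0r subr0 addr0 !eqxx.
Qed.

(** The dilated approximants converge together with their gradients, and D_s fixes the points with
    x_n = 0, so their boundary values are literally those of the original sequence. *)
Lemma is_trace_dil s u Du gu : 0 < s -> H1 half_space u Du ->
  is_trace u Du gu -> is_trace (u \o rV_dil s) (grad_dil s Du) gu.
Proof.
move=> s0 [[LRu LRDu] [LIu LIDu]] [Lg [phi [tphi phiu phiDu phig]]].
split=> //; exists (fun k => phi k \o rV_dil s); split.
- move=> k; have [tR tI] := tphi k; have s0' : s != 0 by rewrite gt_eqF.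
  by split; [have := test_function_dil 1 s0' tR|have := test_function_dil 1 s0' tI];
    congr test_function; apply/funext => x; rewrite mul1r.
- have := cvg_L2_dil 1 s0 _ _ phiu; rewrite /comp.
  under eq_fun do under eq_fun do rewrite mul1r.
  under [X in cvg_L2 _ _ X]eq_fun do rewrite mul1r.
  apply => // k; have [[/(_ 0) cR _ _] [/(_ 0) cI _ _]] := tphi k.
  by split; apply: measurable_funTS; exact: measurable_continuous_rV.
- move=> i.
  have := cvg_L2_dil (dil_coef s i) s0 _ _ (phiDu i).
  rewrite [X in _ -> _ -> cvg_L2 _ X _](_ : _ =
    fun k => cpartial i (phi k \o rV_dil s)); last first.
    apply/funext => k; have [[CR _ _] [CI _ _]] := tphi k.
    by rewrite cpartial_dil.
  apply; last by split; [exact: (LRDu i).1|exact: (LIDu i).1].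
  move=> k; have [tR tI] := tphi k.
  by split; apply: measurable_funTS;
    [exact: measurable_partial tR|exact: measurable_partial tI].
- move: phig; congr cvg_L2; apply/funext => k; apply/funext => y /=.
  by rewrite rV_dil_snoc mulr0.
Qed.

End dilation_H1.

(** * Functions with vanishing normal derivative *)

Section vertical_decay.
Context {R : realType} {d : nat}.
Implicit Types (phi f : 'rV[R]_d.+1 -> R) (y : 'rV[R]_d) (t T : R).

Lemma rV_snoc_line y t :
  rV_snoc y t = t *: delta_mx ord0 ord_max + rV_snoc y 0 :> 'rV[R]_d.+1.
Proof.
apply/rowP => i; rewrite !mxE eqxx /=.
case: (unliftP ord_max i) => [j ->|->] /=.
  by rewrite eq_sym (negbTE (neq_lift _ _)) mulr0 add0r.
by rewrite eqxx mulr1 addr0.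
Qed.

Lemma continuous_rV_snoc y : continuous (rV_snoc y : R -> 'rV[R]_d.+1).
Proof.
move=> t; apply: (@cvg_rV _ _ (nbhs t) _) => i; rewrite mxE.
under eq_fun do rewrite mxE.
by case: (unlift _ _) => [j|] /=; [exact: cvg_cst|exact: cvg_id].
Qed.

Lemma is_derive_snoc phi y t : Ck 1 phi ->
  is_derive t 1 (fun t => phi (rV_snoc y t)) (partial ord_max phi (rV_snoc y t)).
Proof.
move=> [_ /(_ ord_max)[dphi _]].
have : is_derive (rV_snoc y t) (delta_mx ord0 ord_max) phi
    (partial ord_max phi (rV_snoc y t)) by exact/derivableP.
rewrite {1}rV_snoc_line => /is_derive_line.
suff -> : (fun h : R => phi (h *: delta_mx ord0 ord_max + rV_snoc y 0)) =
  (fun t => phi (rV_snoc y t)) by [].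
by apply/funext => h; rewrite -rV_snoc_line.
Qed.

Lemma fsupport_snoc_bounded phi : compact (fsupport phi) ->
  exists M : R, forall y t, M < t -> phi (rV_snoc y t) = 0.
Proof.
move=> cphi.
have : compact ((fun x : 'rV[R]_d.+1 => x ord0 ord_max) @` fsupport phi).
  by apply: continuous_compact => //; apply: continuous_subspaceT; exact: coord_continuous.
move=> /compact_bounded [M [_ HM]].
exists (M + 1) => y t tM; apply/eqP; apply: contraT => phi0.
have : `|t| <= M + 1.
  apply: (HM (M + 1)); first by rewrite ltrDl.
  by exists (rV_snoc y t); [exact: subset_closure|rewrite rV_snoc_max].
by move=> /(le_trans (ler_norm t)); rewrite leNgt tM.
Qed.

(** The fundamental theorem of calculus for phi^2 on the vertical line through y, from height t up
    to a height above the support. *)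
Lemma sqr_le_integral_snoc phi y t : Ck 1 phi -> compact (fsupport phi) -> 0 < t ->
  ((phi (rV_snoc y t) ^+ 2)%:E <=
   \int[lebesgue_measure]_(r in `]0%R, +oo[)
     `|2 * phi (rV_snoc y r) * partial ord_max phi (rV_snoc y r)|%:E)%E.
Proof.
move=> Cphi /fsupport_snoc_bounded[M HM] t0.
pose F (r : R) := phi (rV_snoc y r) ^+ 2.
pose f (r : R) := 2 * phi (rV_snoc y r) * partial ord_max phi (rV_snoc y r).
have dF (r : R) : is_derive r (1 : R) F (f r).
  have H := is_derive_snoc y r Cphi.
  apply: (is_derive_eq (is_deriveM H H)); rewrite /f /GRing.scale /=; ring.
have cphi : continuous (fun r => phi (rV_snoc y r)).
  move=> r; apply: continuous_comp; first exact: continuous_rV_snoc.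
  exact: Ck_continuous Cphi _.
have cdphi : continuous (fun r => partial ord_max phi (rV_snoc y r)).
  move=> r; apply: continuous_comp; first exact: continuous_rV_snoc.
  by case: Cphi => _ /(_ ord_max)[_]; exact.
have cf : continuous f.
  move=> r; apply: (@continuousM _ _ _ _ r); last exact: cdphi.
  by apply: (@continuousM _ _ _ _ r); [exact: cst_continuous|exact: cphi].
have cF : continuous F.
  by move=> r; apply/differentiable_continuous/derivable1_diffP; have [] := dF r.
(* Strictly above M, so that phi vanishes there, and strictly above t, so that [t, N] is a proper
   interval. *)
pose N := Num.max M t + 1.
have tN : t < N by rewrite ltr_pwDr// le_max lexx orbT.
have FN : F N = 0 by rewrite /F HM ?expr0n//= ltr_pwDr// le_max lexx.
have : (\int[lebesgue_measure]_(r in `[t, N]) (f r)%:E = (F N)%:E - (F t)%:E)%E.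
  apply: continuous_FTC2 => //.
  - by apply: continuous_subspaceT.
  - split; first by move=> r _; have [] := dF r.
    + by apply: cvg_at_right_filter; exact: cF.
    + by apply: cvg_at_left_filter; exact: cF.
  - by move=> r _; rewrite derive1E; have [_] := dF r.
rewrite FN sub0e => E.
have -> : ((phi (rV_snoc y t) ^+ 2)%:E =
    `|(\int[lebesgue_measure]_(r in `[t, N]) (f r)%:E)%E|)%E.
  by rewrite E abseN abse_EFin ger0_norm ?sqr_ge0.
apply: le_trans (le_abse_integral _ _ _) _ => //.
  by apply/measurable_EFinP; apply: measurable_funTS; exact: continuous_measurable_fun.
apply: ge0_subset_integral => //.
  apply/measurable_EFinP; apply: measurableT_comp => //.
  by apply: measurable_funTS; exact: continuous_measurable_fun.
move=> r /=; rewrite !in_itv /= andbT => /andP[tr _]; exact: lt_le_trans tr.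
Qed.

(** The bound of [sqr_le_integral_snoc] does not depend on t, so it can be integrated in t only over
    a finite height T, at the cost of a factor T. *)
Definition slab T : set 'rV[R]_d.+1 := [set x | 0 < x ord0 ord_max <= T].

Lemma measurable_slab T : measurable (slab T).
Proof.
rewrite (_ : slab T = (fun x : 'rV[R]_d.+1 => x ord0 ord_max) @^-1` `]0, T]%classic).
  rewrite -[X in measurable X]setTI.
  exact: (measurable_rV_coord ord_max measurableT (measurable_itv `]0, T])).
by apply/seteqP; split=> x; rewrite /slab /= in_itv/=.
Qed.

Lemma mem_slab T (x : 'rV[R]_d.+1) : (x \in slab T) = (0 < x ord0 ord_max <= T).
Proof. by apply/idP/idP; rewrite inE. Qed.

Lemma mem_half_space (x : 'rV[R]_d.+1) : (x \in half_space) = (0 < x ord0 ord_max).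
Proof. by apply/idP/idP; rewrite inE. Qed.

Lemma slab_half_space T : slab T `<=` half_space.
Proof. by move=> x /andP[]. Qed.

Lemma integral_slab_le phi T : Ck 1 phi -> compact (fsupport phi) -> 0 < T ->
  (\int[lebesgue_rV d.+1]_(x in slab T) (phi x ^+ 2)%:E <=
   T%:E * \int[lebesgue_rV d.+1]_(x in half_space)
     `|2 * phi x * partial ord_max phi x|%:E)%E.
Proof.
move=> Cphi cphi T0.
have mphi : measurable_fun setT phi.
  by apply: measurable_continuous_rV; exact: Ck_continuous Cphi.
have mdphi : measurable_fun setT (partial ord_max phi).
  by case: Cphi => _ /(_ ord_max)[_ c1]; exact: measurable_continuous_rV.
pose g1 := (fun x => (phi x ^+ 2)%:E) \_ (slab T).
pose g2 := (fun x => `|2 * phi x * partial ord_max phi x|%:E) \_ half_space.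
have mg1 : measurable_fun setT g1.
  apply/(measurable_restrictT _ (measurable_slab T)); apply: measurable_funTS.
  by apply/measurable_EFinP; exact: measurable_funX.
have mg2 : measurable_fun setT g2.
  apply/(measurable_restrictT _ measurable_half_space); apply: measurable_funTS.
  apply/measurable_EFinP; apply: measurableT_comp => //.
  by apply: measurable_funM => //; exact: measurable_funM.
have g10 x : (0 <= g1 x)%E.
  by rewrite /g1 patchE; case: ifP => // _; rewrite lee_fin sqr_ge0.
have g20 x : (0 <= g2 x)%E by rewrite /g2 patchE; case: ifP => // _; rewrite lee_fin.
pose K y := (\int[lebesgue_measure]_t g2 (rV_snoc y t))%E.
have mK : measurable_fun setT K.
  exact: measurable_integral_snoc.
have K0 y : (0 <= K y)%E by apply: integral_ge0.
rewrite integral_mkcond [X in (_ <= _ * X)%E]integral_mkcond.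
rewrite !integral_lebesgue_rV_snoc// -ge0_integralZl//; last 2 first.
- by move=> y _; exact: K0.
- by rewrite lee_fin ltW.
apply: ge0_le_integral => //.
- by move=> y _; apply: integral_ge0.
- exact: measurable_integral_snoc.
- exact: measurable_funeM.
move=> y _.
(* The factor T becomes the integral of a constant over ]0, T], so that the two sides can be
   compared pointwise in t. *)
have -> : (T%:E * K y = \int[lebesgue_measure]_(t in `]0%R, T]) K y)%E.
  rewrite integral_cst//= muleC lebesgue_measure_itv/= lte_fin T0.
  by rewrite -EFinB subr0.
have -> : (\int[lebesgue_measure]_t g1 (rV_snoc y t) =
    \int[lebesgue_measure]_(t in `]0%R, T]) (phi (rV_snoc y t) ^+ 2)%:E)%E.
  rewrite [RHS]integral_mkcond; apply: eq_integral => t _.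
  rewrite /g1 !patchE; congr (if _ then _ else _).
  by rewrite mem_slab rV_snoc_max mem_setE in_itv.
apply: ge0_le_integral.
- exact: measurable_itv.
- by move=> t _; rewrite lee_fin sqr_ge0.
- apply: measurable_funTS; apply/measurable_EFinP; apply: measurable_funX.
  apply: continuous_measurable_fun => t.
  apply: continuous_comp; first exact: continuous_rV_snoc.
  exact: Ck_continuous Cphi _.
- exact: measurable_cst.
move=> t /=; rewrite in_itv/= => /andP[t0 _].
apply: (le_trans (sqr_le_integral_snoc y Cphi cphi t0)).
rewrite /K integral_mkcond le_eqVlt; apply/orP; left; apply/eqP.
apply: eq_integral => r _; rewrite /g2 !patchE.
by rewrite mem_half_space rV_snoc_max mem_setE in_itv/= andbT.
Qed.

End vertical_decay.

Section vanishing.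
Context {R : realType} {d : nat}.
Let mu := lebesgue_rV (R := R) d.+1.
Implicit Types (a p phi : 'rV[R]_d.+1 -> R) (T : R).

Let mU : measurable (half_space : set 'rV[R]_d.+1) := measurable_half_space.
Let Sq := square_integrable mu half_space.
Let sq := sqL2 mu half_space.

Lemma square_integrable_slab T a : Sq a -> square_integrable mu (slab T) a.
Proof.
move=> [ma ia]; split; first exact: (measurable_funS mU (@slab_half_space R d T)).
exact: (integrableS mU (measurable_slab T) (@slab_half_space R d T)).
Qed.

Lemma sqL2_slab_le T a : Sq a -> sqL2 mu (slab T) a <= sq a.
Proof.
move=> Sa; rewrite -lee_fin /sq (sqL2_EFin mU Sa).
rewrite (sqL2_EFin (measurable_slab T) (square_integrable_slab T Sa)).
apply: ge0_subset_integral.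
- exact: measurable_slab.
- exact: mU.
- by apply/measurable_EFinP; apply: measurable_funX; exact: Sa.1.
- by move=> x _; rewrite lee_fin sqr_ge0.
- exact: slab_half_space.
Qed.

(** The weight e is free. It will be used when |phi| stays bounded and the norm of the normal
    derivative is of order e, which makes both terms of order e. *)
Lemma sqL2_slab_test_le T (e : R) phi : 0 < T -> 0 < e -> Ck 1 phi ->
  compact (fsupport phi) -> Sq phi -> Sq (partial ord_max phi) ->
  sqL2 mu (slab T) phi <= T * (e * sq phi + e^-1 * sq (partial ord_max phi)).
Proof.
move=> T0 e0 Cphi cphi Sphi Sdphi.
rewrite -lee_fin (sqL2_EFin (measurable_slab T) (square_integrable_slab T Sphi)).
apply: (le_trans (integral_slab_le Cphi cphi T0)).
rewrite EFinM; apply: lee_wpmul2l; first by rewrite lee_fin ltW.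
rewrite EFinD !EFinM /sq (sqL2_EFin mU Sphi) (sqL2_EFin mU Sdphi).
have e0' : (0 <= (e^-1)%:E)%E by rewrite lee_fin invr_ge0 ltW.
have m1 : measurable_fun half_space (fun x => (phi x ^+ 2)%:E).
  by apply/measurable_EFinP; apply: measurable_funX; exact: Sphi.1.
have m2 : measurable_fun half_space (fun x => (partial ord_max phi x ^+ 2)%:E).
  by apply/measurable_EFinP; apply: measurable_funX; exact: Sdphi.1.
have p1 (x : 'rV[R]_d.+1) : (0 <= (phi x ^+ 2)%:E)%E by rewrite lee_fin sqr_ge0.
have p2 (x : 'rV[R]_d.+1) : (0 <= (partial ord_max phi x ^+ 2)%:E)%E.
  by rewrite lee_fin sqr_ge0.
rewrite -!ge0_integralZl//; last by rewrite lee_fin ltW.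
rewrite -ge0_integralD//; last 4 first.
- by move=> x _; apply: mule_ge0 => //; rewrite lee_fin ltW.
- exact: measurable_funeM.
- by move=> x _; apply: mule_ge0.
- exact: measurable_funeM.
apply: ge0_le_integral.
- exact: mU.
- by move=> x _; rewrite lee_fin.
- apply/measurable_EFinP; apply: measurableT_comp => //.
  by apply: measurable_funM; [apply: measurable_funM => //; exact: Sphi.1|exact: Sdphi.1].
- by apply: emeasurable_funD; exact: measurable_funeM.
move=> x _; rewrite -!EFinM -EFinD lee_fin.
set b := phi x; set c := partial _ _ _.
have ee : e * e^-1 = 1 by rewrite mulfV// gt_eqF.
have i0 : 0 < e^-1 by rewrite invr_gt0.
(* AM-GM: [2 |b c| <= e b^2 + c^2 / e] *)
rewrite ler_norml; apply/andP; split.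
  have := mulr_ge0 (ltW i0) (sqr_ge0 (e * b + c)).
  rewrite (_ : e^-1 * (e * b + c) ^+ 2 =
    (e * e^-1) * (e * b ^+ 2 + 2 * b * c) + e^-1 * c ^+ 2); last by ring.
  by rewrite ee; lra.
have := mulr_ge0 (ltW i0) (sqr_ge0 (e * b - c)).
rewrite (_ : e^-1 * (e * b - c) ^+ 2 =
  (e * e^-1) * (e * b ^+ 2 - 2 * b * c) + e^-1 * c ^+ 2); last by ring.
by rewrite ee; lra.
Qed.

(** The normal derivatives of [phi_ k] tend to p = 0 in L^2 while the [phi_ k] stay bounded, so the
    slab estimate forces their limit a to vanish on every slab. *)
Lemma ae_eq0_of_partial0 a p (phi_ : nat -> 'rV[R]_d.+1 -> R) : Sq a -> Sq p ->
  sq p = 0 ->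
  (forall k, Ck 1 (phi_ k) /\ compact (fsupport (phi_ k))) ->
  (forall e : R, 0 < e -> \forall k \near \oo,
    Sq (phi_ k \- a) /\ sq (phi_ k \- a) <= e) ->
  (forall e : R, 0 < e -> \forall k \near \oo,
    Sq (partial ord_max (phi_ k) \- p) /\ sq (partial ord_max (phi_ k) \- p) <= e) ->
  {ae mu, forall x, half_space x -> a x = 0}.
Proof.
move=> Sa Sp p0 Cphi phia phip.
have slab0 T : 0 < T -> {ae mu, forall x, slab T x -> a x = 0}.
  move=> T0; apply: (sqL2_eq0 (measurable_slab T) (square_integrable_slab T Sa)).
  apply/eqP; rewrite eq_le sqL2_ge0 andbT; apply/ler_addgt0Pr => h h0; rewrite add0r.
  (* A bound for |phi_k|^2, valid once |phi_k - a|^2 <= e^2 <= 1. *)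
  pose C := 2 * sq a + 2.
  have C0 : 0 < C by have := sqL2_ge0 mu half_space a; rewrite /C /sq; lra.
  have D0 : 0 < 2 * T * (C + 2) + 2 by rewrite addr_gt0// !mulr_gt0// addr_gt0.
  (* The estimates below add up to 2 T (e C + 2 e) + 2 e, that is, e times this denominator; e <= 1
     allows e^2 to be replaced by e. *)
  pose e := Num.min 1 (h / (2 * T * (C + 2) + 2)).
  have e0 : 0 < e by rewrite lt_min ltr01 divr_gt0.
  have e1 : e <= 1 by rewrite ge_min lexx.
  have eh : e * (2 * T * (C + 2) + 2) <= h.
    by rewrite -ler_pdivlMr// ge_min lexx orbT.
  have e20 : 0 < e ^+ 2 by rewrite exprn_gt0.
  have [k _ H] := filterI (phia _ e20) (phip _ e20).
  have [[Sk sk] [Sdk sdk]] := H k (leqnn k).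
  have [Ck1 ck] := Cphi k.
  have Sphi : Sq (phi_ k).
    have := square_integrableD mU Sa Sk; congr square_integrable.
    by apply/funext => x /=; rewrite addrC subrK.
  have Sdphi : Sq (partial ord_max (phi_ k)).
    have := square_integrableD mU Sp Sdk; congr square_integrable.
    by apply/funext => x /=; rewrite addrC subrK.
  have e2e : e ^+ 2 <= e by rewrite expr2 ger_pMr.
  have b1 : sq (phi_ k) <= C.
    have := sqL2D_le mU Sa Sk; rewrite -/mu -/sq.
    rewrite (_ : a \+ (phi_ k \- a) = phi_ k); last first.
      by apply/funext => x /=; rewrite addrC subrK.
    by rewrite /C; lra.
  have b2 : sq (partial ord_max (phi_ k)) <= 2 * e ^+ 2.
    have := sqL2D_le mU Sp Sdk; rewrite -/mu -/sq p0.
    rewrite (_ : p \+ (partial ord_max (phi_ k) \- p) =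
        partial ord_max (phi_ k)); last first.
      by apply/funext => x /=; rewrite addrC subrK.
    by lra.
  have b3 := sqL2_slab_test_le T0 e0 Ck1 ck Sphi Sdphi.
  have SA := square_integrableZ mU (-1) Sk.
  have b4 := sqL2D_le (measurable_slab T)
    (square_integrable_slab T Sphi) (square_integrable_slab T SA).
  have b5 := sqL2_slab_le T SA.
  have Z := sqL2Z mU (-1) Sk; rewrite sqrrN expr1n mul1r in Z.
  rewrite /sq Z -/sq in b5.
  rewrite (_ : phi_ k \+ (fun x => -1 * (phi_ k \- a) x) = a) in b4; last first.
    by apply/funext => x /=; ring.
  have b6 : e * sq (phi_ k) <= e * C by rewrite ler_wpM2l// ltW.
  have b7 : e^-1 * sq (partial ord_max (phi_ k)) <= 2 * e.
    apply: (@le_trans _ _ (e^-1 * (2 * e ^+ 2))).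
      by rewrite ler_wpM2l// invr_ge0 ltW.
    by rewrite expr2 mulrCA mulKf// gt_eqF.
  have b8 : T * (e * sq (phi_ k) + e^-1 * sq (partial ord_max (phi_ k))) <=
      T * (e * C + 2 * e).
    by apply: ler_wpM2l; [exact: ltW|exact: lerD].
  have : 2 * (T * (e * C + 2 * e)) + 2 * e = e * (2 * T * (C + 2) + 2) by ring.
  lra.
(* Slabs of integer height cover the half-space, and countably many null sets form a null set. *)
have := ae_foralln (fun n => slab0 n.+1%:R (ltr0Sn _ n)).
apply: filterS => x /= H x0; apply: (H (Num.truncn (x ord0 ord_max))).
by rewrite /slab /= x0 /=; exact/ltW/truncnS_gt.
Qed.

End vanishing.

(** * The Robin form *)

Section robin_identity.
Context {R : realType} {d : nat}.
Let mu := lebesgue_rV (R := R) d.+1.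
Let mU : measurable (half_space : set 'rV[R]_d.+1) := measurable_half_space.
Let Sq := square_integrable mu half_space.
Let dot := dotL2 mu half_space.
Let sq := sqL2 mu half_space.

Lemma Re_cintegral_gradient (Du Dv : 'I_d.+1 -> 'rV[R]_d.+1 -> R[i]) :
  (forall i, Sq (ReF (Du i))) -> (forall i, Sq (ImF (Du i))) ->
  (forall i, Sq (ReF (Dv i))) -> (forall i, Sq (ImF (Dv i))) ->
  complex.Re (cintegral half_space (fun x => \sum_i Du i x * (Dv i x)^*)) =
  \sum_i (dot (ReF (Du i)) (ReF (Dv i)) + dot (ImF (Du i)) (ImF (Dv i))).
Proof.
move=> RDu IDu RDv IDv; rewrite /cintegral /=.
have iR i := square_integrable_mul mU (RDu i) (RDv i).
have iI i := square_integrable_mul mU (IDu i) (IDv i).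
transitivity (\int[mu]_(x in half_space) \sum_i
    (ReF (Du i) x * ReF (Dv i) x + ImF (Du i) x * ImF (Dv i) x)).
  apply: eq_Rintegral => x _; rewrite /ReF /ImF.
  rewrite Re_sum.
  by apply: eq_bigr => i _; rewrite Re_mulconj.
rewrite Rintegral_sum//; last first.
  by move=> i; have := integrableD mU (iR i) (iI i); apply: eq_integrable.
by apply: eq_bigr => i _; rewrite /dot /dotL2 -RintegralD.
Qed.

Lemma Re_cintegral_dot (l : R) (u v : 'rV[R]_d.+1 -> R[i]) :
  Sq (ReF u) -> Sq (ImF u) -> Sq (ReF v) -> Sq (ImF v) ->
  complex.Re (cintegral half_space (fun x => l%:C * u x * (v x)^*)) =
  l * (dot (ReF u) (ReF v) + dot (ImF u) (ImF v)).
Proof.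
move=> Ru Iu Rv Iv; rewrite /cintegral /=.
have iR := square_integrable_mul mU Ru Rv.
have iI := square_integrable_mul mU Iu Iv.
rewrite /dot /dotL2 -RintegralD// -RintegralZl//; last first.
  by have := integrableD mU iR iI; apply: eq_integrable.
by apply: eq_Rintegral => x _; rewrite /ReF /ImF -mulrA ReZ Re_mulconj.
Qed.

Lemma Im_cintegral_sqr (lambda : R[i]) (u : 'rV[R]_d.+1 -> R[i]) :
  Sq (ReF u) -> Sq (ImF u) ->
  complex.Im (cintegral half_space (fun x => lambda * u x * (u x)^*)) =
  complex.Im lambda * (sq (ReF u) + sq (ImF u)).
Proof.
move=> Ru Iu; rewrite /cintegral /=.
rewrite /sq /sqL2 -(RintegralD mU Ru.2 Iu.2).
rewrite -RintegralZl//; last first.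
  by have := integrableD mU Ru.2 Iu.2; apply: eq_integrable.
apply: eq_Rintegral => x _; rewrite /ReF /ImF.
by case: lambda => l m; case: (u x) => a b /=; ring.
Qed.

(** Each integrand is real pointwise because alpha is. Compared with [Im_cintegral_sqr], this gives
    Im lambda |u|^2 = 0 for an eigenfunction u. *)
Lemma Im_cintegral_form_self (alpha : 'rV[R]_d -> R)
    (Du : 'I_d.+1 -> 'rV[R]_d.+1 -> R[i]) (gu : 'rV[R]_d -> R[i]) :
  complex.Im (robin_form (fun y => (alpha y)%:C) Du gu Du gu) = 0.
Proof.
rewrite /robin_form ImD /cintegral /=.
rewrite (_ : Rintegral _ _ _ = 0); last first.
  rewrite /Rintegral (_ : integral _ _ _ = 0%E)//; apply: integral0_eq => x _.
  congr EFin; rewrite /ImF Im_sum.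
  by apply: big1 => i _; rewrite Im_mulconj_self.
rewrite add0r /Rintegral (_ : integral _ _ _ = 0%E)//; apply: integral0_eq => x _.
congr EFin; rewrite /ImF -mulrA ImZ Im_mulconj_self mulr0 //.
Qed.

Lemma Re_cintegral_boundary_ge0 (alpha : 'rV[R]_d -> R) (gu : 'rV[R]_d -> R[i]) :
  measurable_fun setT alpha -> L2 setT gu ->
  {ae lebesgue_rV d, forall x, 0 <= alpha x} ->
  0 <= complex.Re (cintegral setT (fun y => (alpha y)%:C * gu y * (gu y)^*)).
Proof.
move=> ma [/(square_integrableP _ measurableT)[mR _]].
move=> /(square_integrableP _ measurableT)[mI _] a0.
rewrite /cintegral /=.
rewrite (_ : Rintegral _ _ _ = \int[lebesgue_rV d]_x
    (alpha x * (ReF gu x ^+ 2 + ImF gu x ^+ 2))); last first.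
  by apply: eq_Rintegral => x _; rewrite /ReF -mulrA ReZ Re_mulconj !expr2.
have mg : measurable_fun setT (fun x => ReF gu x ^+ 2 + ImF gu x ^+ 2).
  by apply: measurable_funD; exact: measurable_funX.
rewrite /Rintegral.
(* Since alpha is nonnegative only almost everywhere, it is replaced by max(0, alpha), which changes
   no integral and makes the integrand nonnegative everywhere. *)
rewrite (ae_eq_integral (fun x =>
  (Num.max 0 (alpha x) * (ReF gu x ^+ 2 + ImF gu x ^+ 2))%:E))//.
- apply: fine_ge0; apply: integral_ge0 => x _.
  by rewrite lee_fin mulr_ge0 ?le_max ?lexx// addr_ge0 ?sqr_ge0.
- by apply/measurable_EFinP; exact: measurable_funM.
- apply/measurable_EFinP; apply: measurable_funM => //.
  exact: measurable_maxr.
- by apply: filterS a0 => x /= ax _; rewrite (max_idPr ax).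
Qed.

(** Dilating both factors by s turns (f, f o D_(1/s)) into s (f o D_s, f), and the real product is
    symmetric. This is what relates the identities at s and at 1/s. *)
Lemma dotL2_dilV s f : 0 < s -> Sq f ->
  dot f (f \o rV_dil s^-1) = s * dot f (f \o rV_dil s).
Proof.
move=> s0 Sf; have s0' : s != 0 by rewrite gt_eqF.
have := dotL2_dil s0 Sf (square_integrable_dil (_ : 0 < s^-1) Sf).
rewrite invr_gt0 => /(_ s0).
rewrite (_ : (f \o rV_dil s^-1) \o rV_dil s = f); last first.
  by apply/funext => x /=; rewrite rV_dilK.
by rewrite dotL2C -/mu -/dot => ->; rewrite mulVKf.
Qed.

End robin_identity.

(** * Absence of eigenvalues *)

Theorem theorem1p1 (R : realType) (d : nat) (alpha : 'rV[R]_d -> R)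
    (Dalpha : 'I_d -> 'rV[R]_d -> R)
    (halpha : W1p setT +oo%E alpha Dalpha)
    (alpha_ge0 : {ae lebesgue_rV d, forall x, 0 <= alpha x})
    (x_Dalpha_le0 : {ae lebesgue_rV d, forall x : 'rV[R]_d,
                      \sum_i x ord0 i * Dalpha i x <= 0}) :
  point_spectrum half_space (robin_laplacian (fun x => (alpha x)%:C)) = set0.
Proof.
apply/seteqP; split=> // lambda [u [[_ [Du [gu [Hu Tu form]]]] u_neq0]].
set mu := lebesgue_rV (R := R) d.+1.
have mU := @measurable_half_space R d.
have ma : measurable_fun setT alpha by exact: Lp_measurable halpha.1.
have [[LRu LRDu] [LIu LIDu]] := Hu.
have Lu : L2 half_space u by [].
have LDu i : L2 half_space (Du i) by split; [exact: (LRDu i).1|exact: (LIDu i).1].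
have SR : square_integrable mu half_space (ReF u) by apply/(square_integrableP _ mU).
have SI : square_integrable mu half_space (ImF u) by apply/(square_integrableP _ mU).
have SRD i : square_integrable mu half_space (ReF (Du i)).
  by apply/(square_integrableP _ mU); exact: (LDu i).1.
have SID i : square_integrable mu half_space (ImF (Du i)).
  by apply/(square_integrableP _ mU); exact: (LDu i).2.
have u_ae0 : {ae mu, forall x, half_space x -> ReF u x = 0} ->
             {ae mu, forall x, half_space x -> ImF u x = 0} -> False.
  move=> R0 I0; apply: u_neq0; apply: filterS2 R0 I0 => x /= Rx Ix xU.
  by apply/eqP; rewrite eq_complex; apply/andP; split; apply/eqP; [exact: Rx|exact: Ix].
have lambda_real : complex.Im lambda = 0.
  have := congr1 (@complex.Im R) (form u Du gu Hu Tu).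
  rewrite Im_cintegral_form_self Im_cintegral_sqr// => /esym/eqP.
  rewrite mulf_eq0 => /orP[/eqP//|/eqP sq0]; exfalso.
  have := sqL2_ge0 mu half_space (ReF u); have := sqL2_ge0 mu half_space (ImF u).
  move=> I0 R0; apply: u_ae0; apply: (sqL2_eq0 mU) => //; lra.
pose l := complex.Re lambda.
have lambdaE : lambda = l%:C.
  by apply/eqP; rewrite eq_complex /= lambda_real !eqxx.
pose A := complex.Re (cintegral setT (fun y => (alpha y)%:C * gu y * (gu y)^*)).
have A0 : 0 <= A by exact: Re_cintegral_boundary_ge0 Tu.1 alpha_ge0.
(* [G i s] is Re (D_i u, D_i u o D_s) and [F s] is Re (u, u o D_s); P(s) of the overview is the sum
   of [G i s] over the tangential i, minus [l * F s]. *)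
pose G i s := dotL2 mu half_space (ReF (Du i)) (ReF (Du i) \o rV_dil s) +
              dotL2 mu half_space (ImF (Du i)) (ImF (Du i) \o rV_dil s).
pose F s := dotL2 mu half_space (ReF u) (ReF u \o rV_dil s) +
            dotL2 mu half_space (ImF u) (ImF u \o rV_dil s).
have virial s : 0 < s -> \sum_i dil_coef s i * G i s + A = l * F s.
  move=> s0.
  have := form _ _ _ (H1_dil s0 Hu) (is_trace_dil s0 Hu Tu).
  move=> /(congr1 (@complex.Re R)); rewrite /robin_form ReD -/A lambdaE.
  have Sd f : square_integrable mu half_space f ->
      square_integrable mu half_space (f \o rV_dil s) by exact: square_integrable_dil.
  rewrite (Re_cintegral_dot l (v := u \o rV_dil s) SR SI (Sd _ SR) (Sd _ SI)).
  have RE i : ReF (grad_dil s Du i) = fun x => dil_coef s i * (ReF (Du i) \o rV_dil s) x.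
    by apply/funext => x; rewrite /ReF /grad_dil ReZ.
  have IE i : ImF (grad_dil s Du i) = fun x => dil_coef s i * (ImF (Du i) \o rV_dil s) x.
    by apply/funext => x; rewrite /ImF /grad_dil ImZ.
  rewrite Re_cintegral_gradient//; last 2 first.
  - by move=> i; rewrite RE; apply: square_integrableZ => //; exact: Sd.
  - by move=> i; rewrite IE; apply: square_integrableZ => //; exact: Sd.
  move=> <-; congr (_ + _); apply: eq_bigr => i _.
  rewrite RE IE (dotL2Zr mU _ (SRD i) (Sd _ (SRD i))).
  by rewrite (dotL2Zr mU _ (SID i) (Sd _ (SID i))) -mulrDr.
have GV i s : 0 < s -> G i s^-1 = s * G i s.
  by move=> s0; rewrite /G mulrDr !dotL2_dilV.
have FV s : 0 < s -> F s^-1 = s * F s.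
  by move=> s0; rewrite /F mulrDr !dotL2_dilV.
(* The identity at [s], multiplied by [s], minus the one at [1 / s]. *)
have Gle0 s : 1 < s -> G ord_max s <= 0.
  move=> s1; have s0 : 0 < s by exact: lt_trans s1.
  have V1 := virial _ s0.
  have s0' : 0 < s^-1 by rewrite invr_gt0.
  have V2 := virial _ s0'.
  move: V1 V2; rewrite (bigD1 ord_max)//= [X in _ -> X + _ = _ -> _](bigD1 ord_max)//=.
  rewrite /dil_coef eqxx FV// GV// mulKf ?gt_eqF//.
  under eq_bigr => i /negbTE -> do rewrite mul1r.
  under [X in _ -> _ + X + _ = _ -> _]eq_bigr => i /negbTE iM do rewrite iM mul1r GV//.
  rewrite -mulr_sumr; set S := \sum_(i < _ | _) _ => V1 V2.
  (* The tangential sum S and the eigenvalue term both gain a factor s under inversion and cancel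
     whatever their signs; the rest is (s^2 - 1) G + (s - 1) A. *)
  have E : (s - 1) * ((s + 1) * G ord_max s + A) = 0.
    transitivity (s * (s * G ord_max s + S + A) - (G ord_max s + s * S + A)); first by ring.
    by rewrite V1 V2; ring.
  move/eqP: E; rewrite mulf_eq0 subr_eq0 (gt_eqF s1)/= => /eqP E.
  have : (s + 1) * G ord_max s <= 0 by lra.
  by rewrite pmulr_rle0// addr_gt0.
(* The approximants witnessing the trace are reused for their convergence in the interior. *)
have [_ [phi [tphi phiu phiDu _]]] := Tu.
have tR k : test_function setT (ReF (phi k)) by exact: (tphi k).1.
have tI k : test_function setT (ImF (phi k)) by exact: (tphi k).2.
have cphi f : test_function [set: 'rV[R]_d.+1] f -> measurable_fun half_space f.
  by case=> /(_ 0) cf _ _; apply: measurable_funTS; exact: measurable_continuous_rV.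
have cdphi f : test_function [set: 'rV[R]_d.+1] f -> continuous (partial ord_max f).
  by case=> /(_ 1)[_ /(_ ord_max)[_ cf]] _ _; exact: cf.
have mphi k : measurable_fun half_space (ReF (phi k)) /\
              measurable_fun half_space (ImF (phi k)).
  by split; exact: cphi.
have mdphi k : measurable_fun half_space (ReF (cpartial ord_max (phi k))) /\
               measurable_fun half_space (ImF (cpartial ord_max (phi k))).
  by split; apply: measurable_funTS; apply: measurable_continuous_rV; exact: cdphi.
have cvg_u := cvg_L2_parts mU mphi Lu phiu.
have cvg_Du := cvg_L2_parts mU mdphi (LDu ord_max) (phiDu ord_max).
have cvgR e : 0 < e -> \forall k \near \oo,
    square_integrable mu half_space (ReF (phi k) \- ReF u) /\
    sqL2 mu half_space (ReF (phi k) \- ReF u) <= e.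
  by move=> e0; apply: filterS (cvg_u e e0) => k [].
have cvgI e : 0 < e -> \forall k \near \oo,
    square_integrable mu half_space (ImF (phi k) \- ImF u) /\
    sqL2 mu half_space (ImF (phi k) \- ImF u) <= e.
  by move=> e0; apply: filterS (cvg_u e e0) => k [].
have cvgDR e : 0 < e -> \forall k \near \oo,
    square_integrable mu half_space
      (partial ord_max (ReF (phi k)) \- ReF (Du ord_max)) /\
    sqL2 mu half_space (partial ord_max (ReF (phi k)) \- ReF (Du ord_max)) <= e.
  by move=> e0; apply: filterS (cvg_Du e e0) => k [].
have cvgDI e : 0 < e -> \forall k \near \oo,
    square_integrable mu half_space
      (partial ord_max (ImF (phi k)) \- ImF (Du ord_max)) /\
    sqL2 mu half_space (partial ord_max (ImF (phi k)) \- ImF (Du ord_max)) <= e.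
  by move=> e0; apply: filterS (cvg_Du e e0) => k [].
have [DR0 DI0] := sqL2_eq0_of_dil (SRD ord_max) (SID ord_max)
  (fun k => cdphi _ (tR k)) (fun k => cdphi _ (tI k)) cvgDR cvgDI Gle0.
apply: u_ae0.
- apply: (ae_eq0_of_partial0 SR (SRD ord_max) DR0 _ cvgR cvgDR) => k.
  by have [Ck ck _] := tR k; split; [exact: Ck|].
- apply: (ae_eq0_of_partial0 SI (SID ord_max) DI0 _ cvgI cvgDI) => k.
  by have [Ck ck _] := tI k; split; [exact: Ck|].
Qed.
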